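(* Let $m\ge 1$ be an integer, let $u=(u_1,\ldots,u_m)\in\mathbb{C}^m$ with $u\neq(0,\ldots,0)$, let $p_1,p_2,\lambda_1,\ldots,\lambda_m$ be non-zero complex constants, let $\lambda=(\lambda_1,\ldots,\lambda_m)$, and let $l\geq 1$ be an odd integer. Then the partial differential equation $$f^3(z)+\partial_u^l(f(z))=p_1e^{\langle\lambda,\overline{z}\rangle}+p_2e^{-\langle\lambda,\overline{z}\rangle}$$ has no transcendental entire solutions $f$ in $\mathbb{C}^m$.
   Context: Notation: for $\lambda\in\mathbb{C}^m$ and $z=(z_1,\ldots,z_m)\in\mathbb{C}^m$, $\langle\lambda,\overline{z}\rangle=\sum_{k=1}^m\lambda_k z_k$. For $u\in\mathbb{C}^m\setminus\{0\}$, $\partial_u(f)=\sum_{j=1}^m u_j\frac{\partial f}{\partial z_j}$, and inductively $\partial_u^k(f)=\partial_u(\partial_u^{k-1}(f))$. An entire function in $\mathbb{C}^m$ is a holomorphic function $\mathbb{C}^m\to\mathbb{C}$; it is transcendental if it is not a polynomial. *)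

(* Defs.v *)
From mathcomp Require Import all_boot all_order all_algebra.
From mathcomp Require Import complex.
From mathcomp Require Import all_classical all_reals all_analysis.
(* Not imported: the notations of [mpoly] clash with those of MathComp-Analysis. *)
From mathcomp Require mpoly.

Set Implicit Arguments.
Unset Strict Implicit.
Unset Printing Implicit Defensive.

Import Order.TTheory GRing.Theory Num.Theory.
Import numFieldNormedType.Exports.

#[global] Open Scope ring_scope.
#[global] Open Scope complex_scope.

Definition cexp (R : realType) (z : R[i]) : R[i] :=
  (expR (complex.Re z) * cos (complex.Im z)) +i*
  (expR (complex.Re z) * sin (complex.Im z)).

(* The pairing <lam, conj z>: bilinear, since the Hermitian product already
   conjugates its second argument. *)
Definition pairing (R : realType) (m : nat) (lam z : 'rV[R[i]]_m) : R[i] :=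
  \sum_(k < m) lam 0 k * z 0 k.

(* The topology and norm of MathComp-Analysis are attached to the numFieldType
   structure of the complex numbers, hence the explicit cast: [differentiable]
   and ['D_v] are the Frechet and directional derivatives over the field R[i],
   that is, complex derivatives. *)
Definition CC (R : realType) : numFieldType := R[i].

Definition entire (R : realType) (m : nat) (f : 'rV[R[i]]_m -> R[i]) : Prop :=
  forall z, differentiable (f : 'rV[CC R]_m -> CC R) z.

Definition transcendental (R : realType) (m : nat)
    (f : 'rV[R[i]]_m -> R[i]) : Prop :=
  ~ exists P : mpoly.mpoly m R[i],
      forall z, f z = mpoly.meval (fun k => z 0 k) P.

Definition partial (R : realType) (m : nat) (j : 'I_m)
    (f : 'rV[R[i]]_m -> R[i]) (z : 'rV[R[i]]_m) : R[i] :=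
  'D_(delta_mx 0 j : 'rV[CC R]_m) (f : 'rV[CC R]_m -> CC R) z.

Definition dirder (R : realType) (m : nat) (u : 'rV[R[i]]_m)
    (f : 'rV[R[i]]_m -> R[i]) (z : 'rV[R[i]]_m) : R[i] :=
  \sum_(j < m) u 0 j * partial j f z.

(* Main.v *)
Require Import Defs.
From mathcomp Require Import all_boot all_order all_algebra.
From mathcomp Require Import complex.
From mathcomp Require Import all_classical all_reals all_analysis.
From mathcomp Require Import ring lra.

Set Implicit Arguments.
Unset Strict Implicit.
Unset Printing Implicit Defensive.

Import Order.TTheory GRing.Theory Num.Theory.
Import numFieldNormedType.Exports.
Import Normc.

(* Restricted to a line parallel to [u], the equation becomes
     g ^ 3 + kappa g^(l) = A e^(3s) + B e^(-3s)
   (after rescaling, if <lam, u> <> 0), or g ^ 3 + g^(l) = const (if <lam, u> = 0).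
   A cubic term dominates a derivative: the Cauchy estimates show that |g p| <= C
   max(1, |rhs|)^(1/3), with the maximum taken over the unit disc at p. In the
   second case [g] is therefore bounded, hence constant by Liouville, so the
   derivative term vanishes and f ^ 3 is the right-hand side, which on another line
   is the first case with kappa = 0. In the first case |g s| <= C e^|Re s|, and
   comparing the equation with its derivative gives g ^ 2 (g' - g) = O(e^(Re s))
   while |g| ^ 2 >= c e^(2 Re s) far to the right; so g' - g, and then g'' - g, is
   O(e^(- Re s)) there, and symmetrically on the left. Thus g'' - g is bounded and
   tends to 0, so g'' = g and g = a e^s + b e^(-s). Since l is odd, comparing
   coefficients yields 3 a b + kappa = 3 a b - kappa = 0 with a, b <> 0, which is
   absurd. *)

(** * The real-valued modulus of complex numbers *)

Section ComplexModulus.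
Variable R : realType.
Implicit Types (x y z : R[i]) (a b : R).

Lemma normc_ge0 z : 0 <= normc z.
Proof. by case: z => a b; exact: sqrtr_ge0. Qed.

Lemma normcD x y : normc (x + y) <= normc x + normc y.
Proof. exact: (@le_normcD R x y). Qed.

Lemma normcNE z : normc (- z) = normc z.
Proof. exact: (@normcN R z). Qed.

Lemma normc_distC x y : normc (x - y) = normc (y - x).
Proof. by rewrite -normcNE opprB. Qed.

Lemma normcB x y : normc (x - y) <= normc x + normc y.
Proof. by rewrite -(normcNE y); exact: normcD. Qed.

Lemma normc_distD z x y : normc (x - y) <= normc (x - z) + normc (z - y).
Proof. by rewrite (_ : x - y = (x - z) + (z - y)) ?normcD//; ring. Qed.

Lemma normcX z n : normc (z ^+ n) = normc z ^+ n.
Proof.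
elim: n => [|n IH]; first by rewrite !expr0 normc1.
by rewrite !exprS normcM IH.
Qed.

Lemma normc_real a : normc a%:C = `|a|.
Proof. by rewrite /= expr0n /= addr0 sqrtr_sqr. Qed.

Lemma normc_i : normc ('i%C : R[i]) = 1.
Proof. by rewrite /= expr0n /= add0r expr1n sqrtr1. Qed.

Lemma normc_eq0 z : (normc z == 0) = (z == 0).
Proof.
apply/eqP/eqP => [/eq0_normc//|->]; exact: normc0.
Qed.

Lemma normc_gt0 z : (0 < normc z) = (z != 0).
Proof. by rewrite lt_def normc_ge0 andbT normc_eq0. Qed.

Lemma normc_Re z : `|complex.Re z| <= normc z.
Proof.
case: z => a b /=; rewrite -sqrtr_sqr ler_sqrt ?addr_ge0 ?sqr_ge0//.
by rewrite lerDl sqr_ge0.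
Qed.

Lemma normc_Im z : `|complex.Im z| <= normc z.
Proof.
case: z => a b /=; rewrite -sqrtr_sqr ler_sqrt ?addr_ge0 ?sqr_ge0//.
by rewrite lerDr sqr_ge0.
Qed.

Lemma normc_ReIm z : normc z <= `|complex.Re z| + `|complex.Im z|.
Proof.
rewrite [in X in X <= _](complexE z); apply: le_trans (normcD _ _) _.
by rewrite normcM normc_i mul1r !normc_real.
Qed.

(** Turns approximation into equality: uniqueness of derivatives, Goursat's theorem, symmetry of
    mixed derivatives and Liouville's theorem all rest on it. *)
Lemma normc_small_eq0 z (K : R) :
  (forall e : R, 0 < e -> normc z <= K * e) -> z = 0.
Proof.
move=> H; apply: eq0_normc; apply/eqP; rewrite eq_le normc_ge0 andbT.
apply/ler_addgt0Pr => e e0; rewrite add0r.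
have K0 : 0 < `|K| + 1 by rewrite ltr_pwDr.
have := H (e / (`|K| + 1)) (divr_gt0 e0 K0).
move=> /le_trans; apply; rewrite mulrA ler_pdivrMr// mulrC ler_pM2l//.
by have := ler_norm K; lra.
Qed.

End ComplexModulus.

(** * Subdivision of rectangles, in place of compactness *)

Section Bisection.
Variable R : realType.
Variable P : R -> R -> R -> R -> Prop.
Hypothesis P_glue : forall x y a b : R, 0 <= a -> 0 <= b ->
  P x y (a / 2) (b / 2) -> P (x + a / 2) y (a / 2) (b / 2) ->
  P x (y + b / 2) (a / 2) (b / 2) ->
  P (x + a / 2) (y + b / 2) (a / 2) (b / 2) -> P x y a b.
Hypothesis P_local : forall X Y : R, exists2 d : R, 0 < d &
  forall x y a b, x <= X <= x + a -> y <= Y <= y + b ->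
    0 <= a < d -> 0 <= b < d -> P x y a b.

(** [P x y a b] speaks of the rectangle with lower left corner [(x, y)], width [a] and height [b].
    By [P_glue] a bad rectangle has a bad quarter; the nested bad quarters shrink to a point, where
    [P_local] refutes them. This serves the mean value inequality, Goursat's theorem and boundedness
    on discs. *)
Lemma rectangle_bisection x y a b : 0 <= a -> 0 <= b -> P x y a b.
Proof.
move=> a0 b0; apply: contrapT => NP.
pose bad (n : nat) (p : R * R) := ~ P p.1 p.2 (a / 2 ^+ n) (b / 2 ^+ n).
(* Badness of [p] is a premise inside the existential, so that [q] can be chosen as a total function
   of [n] and [p]. *)
have step (n : nat) (p : R * R) : exists q : R * R,
    bad n p -> [/\ bad n.+1 q, p.1 <= q.1, q.1 + a / 2 ^+ n.+1 <= p.1 + a / 2 ^+ n,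
                  p.2 <= q.2 & q.2 + b / 2 ^+ n.+1 <= p.2 + b / 2 ^+ n].
  have an : 0 <= a / 2 ^+ n by rewrite divr_ge0// exprn_ge0.
  have bn : 0 <= b / 2 ^+ n by rewrite divr_ge0// exprn_ge0.
  have hS (c : R) : c / 2 ^+ n.+1 = c / 2 ^+ n / 2.
    by rewrite exprSr invfM mulrA.
  case: p => p1 p2.
  have [h1|h1] := pselect (P p1 p2 (a / 2 ^+ n.+1) (b / 2 ^+ n.+1)); last first.
    exists (p1, p2) => _; rewrite /bad /= !hS -?hS; split => //; rewrite ?hS; lra.
  have [h2|h2] := pselect (P (p1 + a / 2 ^+ n.+1) p2 (a / 2 ^+ n.+1) (b / 2 ^+ n.+1)); last first.
    exists (p1 + a / 2 ^+ n.+1, p2) => _; rewrite /bad /=; split => //; rewrite ?hS; lra.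
  have [h3|h3] := pselect (P p1 (p2 + b / 2 ^+ n.+1) (a / 2 ^+ n.+1) (b / 2 ^+ n.+1)); last first.
    exists (p1, p2 + b / 2 ^+ n.+1) => _; rewrite /bad /=; split => //; rewrite ?hS; lra.
  have [h4|h4] := pselect (P (p1 + a / 2 ^+ n.+1) (p2 + b / 2 ^+ n.+1)
      (a / 2 ^+ n.+1) (b / 2 ^+ n.+1)); last first.
    exists (p1 + a / 2 ^+ n.+1, p2 + b / 2 ^+ n.+1) => _.
    by rewrite /bad /=; split => //; rewrite ?hS; lra.
  exists (p1, p2) => []; case; rewrite /=.
  by apply: P_glue => //; rewrite -!hS.
pose next n p := sval (cid (step n p)).
have nextP n p : bad n p -> [/\ bad n.+1 (next n p), p.1 <= (next n p).1,
    (next n p).1 + a / 2 ^+ n.+1 <= p.1 + a / 2 ^+ n,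
    p.2 <= (next n p).2 & (next n p).2 + b / 2 ^+ n.+1 <= p.2 + b / 2 ^+ n].
  exact: svalP (cid (step n p)).
pose s := fix s n := if n is k.+1 then next k (s k) else (x, y).
have sbad n : bad n (s n).
  by elim: n => [|n /nextP[]//]; rewrite /bad /= !expr0 !divr1.
(* Nested intervals: the left ends increase and the right ends decrease, so the supremum of the left
   ends lies in all of them. *)
have lim (c : R) (u : nat -> R) : 0 <= c ->
    (forall n, u n <= u n.+1) ->
    (forall n, u n.+1 + c / 2 ^+ n.+1 <= u n + c / 2 ^+ n) ->
    exists X, forall n, u n <= X <= u n + c / 2 ^+ n.
  move=> c0 u1 u2.
  have cn n : 0 <= c / 2 ^+ n by rewrite divr_ge0// exprn_ge0.
  have um n k : u n <= u (n + k)%N.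
    by elim: k => [|k IH]; rewrite ?addn0// addnS (le_trans IH).
  have ud n k : u (n + k)%N + c / 2 ^+ (n + k)%N <= u n + c / 2 ^+ n.
    by elim: k => [|k IH]; rewrite ?addn0// addnS (le_trans _ IH).
  have ub n k : u k <= u n + c / 2 ^+ n.
    have [nk|/ltnW kn] := leqP n k.
      have := ud n (k - n)%N; rewrite subnKC// => h.
      by have := cn k; lra.
    have := um k (n - k)%N; rewrite subnKC// => h.
    by have := cn n; lra.
  exists (sup (range u)) => n; apply/andP; split.
    apply: ub_le_sup; last by exists n.
    by exists (u n + c / 2 ^+ n) => _ [k _ <-].
  apply: ge_sup; first by exists (u n), n.
  by move=> _ [k _ <-].
have [X hX] := lim a (fun n => (s n).1) a0
  (fun n => let: And5 _ h _ _ _ := nextP n _ (sbad n) in h)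
  (fun n => let: And5 _ _ h _ _ := nextP n _ (sbad n) in h).
have [Y hY] := lim b (fun n => (s n).2) b0
  (fun n => let: And5 _ _ _ h _ := nextP n _ (sbad n) in h)
  (fun n => let: And5 _ _ _ _ h := nextP n _ (sbad n) in h).
have [d d0 Pd] := P_local X Y.
have small (c : R) : 0 <= c -> exists N, forall n, (N <= n)%N -> c / 2 ^+ n < d.
  move=> c0; exists (Num.bound (c / d)) => n Nn.
  have := archi_boundP (divr_ge0 c0 (ltW d0)).
  rewrite ltr_pdivrMr// => h.
  rewrite ltr_pdivrMr ?exprn_gt0//; apply: lt_le_trans h _.
  rewrite mulrC ler_pM2l// -natrX ler_nat (leq_trans Nn)//.
  exact/ltnW/ltn_expl.
have [[N1 h1] [N2 h2]] := (small a a0, small b b0).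
apply: (sbad (maxn N1 N2)); apply: Pd => //.
  by rewrite divr_ge0 ?exprn_ge0//= h1// leq_maxl.
by rewrite divr_ge0 ?exprn_ge0//= h2// leq_maxr.
Qed.

End Bisection.

(** * Complex-valued functions of a real variable: derivatives and primitives *)

Section RealVariable.
Local Open Scope classical_set_scope.
Variable R : realType.
Implicit Types (F G phi : R -> R[i]) (t : R) (d : R[i]).

(** Stated without division, so that [h = 0] is harmless and error terms can simply be added. *)
Definition rder F t d := forall e : R, 0 < e -> exists2 dl : R, 0 < dl &
  forall h : R, `|h| < dl -> normc (F (t + h) - F t - h%:C * d) <= e * `|h|.

Definition rcont F t := forall e : R, 0 < e -> exists2 dl : R, 0 < dl &
  forall h : R, `|h| < dl -> normc (F (t + h) - F t) <= e.

Lemma rderB F G t d e : rder F t d -> rder G t e ->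
  rder (fun x => F x - G x) t (d - e).
Proof.
move=> dF dG ep ep0; have e2 : 0 < ep / 2 by rewrite divr_gt0.
have [d1 d10 h1] := dF _ e2; have [d2 d20 h2] := dG _ e2.
exists (Num.min d1 d2); first by rewrite lt_min d10.
move=> h; rewrite lt_min => /andP[/h1 H1 /h2 H2].
rewrite (_ : _ - _ = (F (t + h) - F t - h%:C * d) - (G (t + h) - G t - h%:C * e));
  last by ring.
apply: le_trans (normcB _ _) _; lra.
Qed.

(** With the slope [M + e] the inequality holds locally by differentiability and survives the gluing
    of adjacent intervals, so bisection applies. *)
Lemma rder_mvt F (F' : R -> R[i]) (a b M : R) : a <= b ->
  (forall t, a <= t <= b -> rder F t (F' t)) ->
  (forall t, a <= t <= b -> normc (F' t) <= M) ->
  normc (F b - F a) <= M * (b - a).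
Proof.
move=> ab dF bF; apply/ler_addgt0Pr => e0 e00.
pose e := e0 / (b - a + 1).
have ba : 0 < b - a + 1 by lra.
have e_gt0 : 0 < e by rewrite divr_gt0.
suff : normc (F b - F a) <= (M + e) * (b - a).
  have : e * (b - a) <= e0.
    by rewrite /e mulrAC ler_pdivrMr// ler_pM2l//; lra.
  by rewrite mulrDl; lra.
(* The interval from [x] to [x + w] is treated as a rectangle of height 0. *)
pose P (x y w h : R) := a <= x -> x + w <= b ->
  normc (F (x + w) - F x) <= (M + e) * w.
suff : P a 0 (b - a) 0 by rewrite /P subrKC; apply => //; lra.
apply: (@rectangle_bisection R P) => //; last by lra.
- move=> x y w h w0 h0 P1 P2 _ _ ax xb.
  have H1 : normc (F (x + w / 2) - F x) <= (M + e) * (w / 2) by apply: P1; lra.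
  have H2 : normc (F (x + w) - F (x + w / 2)) <= (M + e) * (w / 2).
    have -> : x + w = x + w / 2 + w / 2 by lra.
    by apply: P2; lra.
  by have := normc_distD (F (x + w / 2)) (F (x + w)) (F x); lra.
- move=> X Y.
  have [aXb|naXb] := pselect (a <= X <= b); last first.
    exists 1 => // x y w h xX _ _ _ ax xb; case: naXb; lra.
  have [d d0 hd] := dF X aXb e e_gt0.
  have M0 : 0 <= M by apply: le_trans (bF X aXb); exact: normc_ge0.
  exists d => // x y w h /andP[xX Xw] _ /andP[w0 wd] _ ax xb.
  (* [X] lies between [x] and [x + w], so the bounds on its two sides add up to one for the whole
     interval. *)
  have near k : `|k| < d -> normc (F (X + k) - F X) <= (M + e) * `|k|.
    move=> kd; have := hd k kd; have := bF X aXb => H1 H2.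
    have := normcD (F (X + k) - F X - k%:C * F' X) (k%:C * F' X).
    rewrite subrK normcM normc_real.
    have := ler_wpM2l (normr_ge0 k) H1; lra.
  have k1 : `|x - X| = X - x by rewrite ler0_norm; lra.
  have k2 : `|x + w - X| = x + w - X by rewrite ger0_norm; lra.
  have := near (x - X); have := near (x + w - X).
  rewrite !subrKC k1 k2 => H1 H2.
  have {}H1 : normc (F (x + w) - F X) <= (M + e) * (x + w - X) by apply: H1; lra.
  have {}H2 : normc (F x - F X) <= (M + e) * (X - x) by apply: H2; lra.
  have := normc_distD (F X) (F (x + w)) (F x).
  by rewrite (normc_distC (F X)) => H; lra.
Qed.

Lemma ReB (x y : R[i]) : complex.Re (x - y) = complex.Re x - complex.Re y.
Proof. by case: x y => [a b] [c d]. Qed.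

Lemma ImB (x y : R[i]) : complex.Im (x - y) = complex.Im x - complex.Im y.
Proof. by case: x y => [a b] [c d]. Qed.

Lemma rcont_Re F t : rcont F t -> {for t, continuous (fun s => complex.Re (F s))}.
Proof.
move=> cF; apply/cvgrPdist_le => e e0; have [d d0 hd] := cF e e0.
near=> x; have xt : `|x - t| < d.
  by rewrite distrC; near: x; exact: cvgr_dist_lt.
have := hd _ xt; rewrite subrKC => H.
rewrite distrC /= -ReB.
exact: le_trans (normc_Re _) H.
Unshelve. all: by end_near. Qed.

Lemma rcont_Im F t : rcont F t -> {for t, continuous (fun s => complex.Im (F s))}.
Proof.
move=> cF; apply/cvgrPdist_le => e e0; have [d d0 hd] := cF e e0.
near=> x; have xt : `|x - t| < d.
  by rewrite distrC; near: x; exact: cvgr_dist_lt.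
have := hd _ xt; rewrite subrKC => H.
rewrite distrC /= -ImB.
exact: le_trans (normc_Im _) H.
Unshelve. all: by end_near. Qed.

Lemma derive1_littleo (f : R -> R) (t d : R) : derivable f t 1 -> derive1 f t = d ->
  forall e : R, 0 < e -> exists2 dl : R, 0 < dl &
  forall h : R, `|h| < dl -> `|f (t + h) - f t - h * d| <= e * `|h|.
Proof.
rewrite derive1E => df <- e e0.
have /cvgrPdist_le /(_ e e0) : h^-1 *: (f (h *: (1 : R) + t) - f t) @[h --> 0^'] -->
  'D_1 f t by exact: df.
move=> /nbhs_ballP[dl /= dl0 H]; exists dl => // h hdl.
have [->|h0] := eqVneq h 0; first by rewrite addr0 subrr mul0r subrr !normr0 mulr0.
have := H h; rewrite /ball /= sub0r normrN => /(_ hdl h0).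
rewrite /GRing.scale /= mulr1 (addrC h t) => H'.
have h_gt0 : 0 < `|h| by rewrite normr_gt0.
rewrite -ler_pdivrMr// -normfV -normrM; rewrite distrC in H'.
by apply: le_trans H'; rewrite le_eqVlt; apply/orP; left; apply/eqP; congr `|_|; field.
Qed.

Lemma real_antiderivative (f : R -> R) (a : R) : continuous f ->
  exists g : R -> R, forall t, a < t -> derivable g t 1 /\ derive1 g t = f t.
Proof.
move=> cf.
exists (fun x => \int[lebesgue_measure]_(t in [set` `[a, x]]) (f t))%R => t at_.
(* The right end [t + 1] puts [t] in the interior of the interval of integration. *)
apply: (@continuous_FTC1_closed R f a t (t + 1)); [lra| |done|exact: cf].
apply: continuous_compact_integrable; first exact: segment_compact.
by apply: continuous_subspaceT => x; exact: cf.
Qed.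

Lemma antiderivative_ex phi (a : R) : (forall t, rcont phi t) ->
  exists F, forall t, a < t -> rder F t (phi t).
Proof.
move=> cphi.
have [g hg] := real_antiderivative a (fun t => rcont_Re (cphi t)).
have [k hk] := real_antiderivative a (fun t => rcont_Im (cphi t)).
exists (fun t => g t +i* k t) => t at_ e e0.
have e2 : 0 < e / 2 by rewrite divr_gt0.
have [dg g'] := hg t at_; have [dk k'] := hk t at_.
have [d1 d10 h1] := derive1_littleo dg g' e2.
have [d2 d20 h2] := derive1_littleo dk k' e2.
exists (Num.min d1 d2); first by rewrite lt_min d10.
move=> h; rewrite lt_min => /andP[/h1 H1 /h2 H2].
apply: le_trans (normc_ReIm _) _.
move: H1 H2 => /=; case: (phi t) => u v /=; rewrite !mul0r subr0 addr0.
lra.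
Qed.

(* An antiderivative on [ ]a, +oo[ ]; the junk value is [phi] if there is none. *)
Definition prim (a : R) (phi : R -> R[i]) : R -> R[i] :=
  xget phi [set F | forall t, a < t -> rder F t (phi t)].

Lemma primP (a : R) phi t : (forall t, rcont phi t) -> a < t ->
  rder (prim a phi) t (phi t).
Proof.
move=> cphi; have := antiderivative_ex a cphi => exF at_.
exact: (@xgetPex _ phi [set F | forall t, a < t -> rder F t (phi t)] exF).
Qed.

(** The usual estimate of an integral: increments of [prim a phi] are integrals of [phi], and the
    mean value inequality applies to [prim a phi - G], whose derivative is [phi - G']. *)
Lemma prim_approx (a x y M : R) phi (G G' : R -> R[i]) :
  (forall t, rcont phi t) -> a < x -> x <= y ->
  (forall t, x <= t <= y -> rder G t (G' t)) ->
  (forall t, x <= t <= y -> normc (phi t - G' t) <= M) ->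
  normc (prim a phi y - prim a phi x - (G y - G x)) <= M * (y - x).
Proof.
move=> cphi ax xy dG hM.
rewrite (_ : _ - _ = prim a phi y - G y - (prim a phi x - G x)); last by ring.
apply: (rder_mvt (F := fun t => prim a phi t - G t) (F' := fun t => phi t - G' t)) => //.
move=> t /[dup] xty /andP[xt ty]; apply: rderB; last exact: dG.
by apply: primP => //; lra.
Qed.

End RealVariable.

(** * Complex derivatives in one variable *)

Section ComplexDerivative.
Variable R : realType.
Implicit Types (f g e : R[i] -> R[i]) (z w d : R[i]).

Definition littleo e := forall ep : R, 0 < ep -> exists2 dl : R, 0 < dl &
  forall h, normc h < dl -> normc (e h) <= ep * normc h.

Definition cder g z d := littleo (fun h => g (z + h) - g z - h * d).

Lemma littleoD e1 e2 : littleo e1 -> littleo e2 -> littleo (fun h => e1 h + e2 h).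
Proof.
move=> o1 o2 ep ep0; have e20 : 0 < ep / 2 by rewrite divr_gt0.
have [d1 d10 h1] := o1 _ e20; have [d2 d20 h2] := o2 _ e20.
exists (Num.min d1 d2); first by rewrite lt_min d10.
move=> h; rewrite lt_min => /andP[/h1 H1 /h2 H2].
by apply: le_trans (normcD _ _) _; lra.
Qed.

Lemma littleo_bounded (b : R[i] -> R[i]) e (K dl : R) : 0 < dl ->
  (forall h, normc h < dl -> normc (b h) <= K) -> littleo e ->
  littleo (fun h => b h * e h).
Proof.
move=> dl0 bK oe ep ep0.
have K0 : 0 <= K.
  by have := bK 0; rewrite normc0 => /(_ dl0); apply: le_trans; exact: normc_ge0.
have K1 : 0 < K + 1 by lra.
have [d1 d10 h1] := oe _ (divr_gt0 ep0 K1).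
exists (Num.min d1 dl); first by rewrite lt_min d10.
move=> h; rewrite lt_min => /andP[/h1 H1 /bK H2].
rewrite normcM; apply: le_trans (ler_pM (normc_ge0 _) (normc_ge0 _) H2 H1) _.
rewrite !mulrA ler_wpM2r ?normc_ge0// ler_pdivrMr//.
by rewrite [leRHS]mulrC ler_pM2r//; lra.
Qed.

Lemma littleoZ (a : R[i]) e : littleo e -> littleo (fun h => a * e h).
Proof. by apply: (littleo_bounded (K := normc a) (dl := 1)). Qed.

Lemma littleo_ext e1 e2 : (forall h, e1 h = e2 h) -> littleo e1 -> littleo e2.
Proof. by move=> /funext ->. Qed.

Lemma littleo0 : littleo (fun=> 0).
Proof.
by move=> ep ep0; exists 1 => // h _; rewrite normc0 mulr_ge0 ?normc_ge0// ltW.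
Qed.

Lemma cder_lip g z d : cder g z d -> exists2 dl : R, 0 < dl &
  forall h, normc h < dl -> normc (g (z + h) - g z) <= (normc d + 1) * normc h.
Proof.
move=> /(_ 1 ltr01)[dl dl0 H]; exists dl => // h /H {}H.
have := normcD (g (z + h) - g z - h * d) (h * d).
by rewrite subrK normcM; lra.
Qed.

Lemma cder_cont g z d : cder g z d -> forall ep : R, 0 < ep -> exists2 dl : R, 0 < dl &
  forall h, normc h < dl -> normc (g (z + h) - g z) <= ep.
Proof.
move=> /cder_lip[dl dl0 H] ep ep0.
have K0 : 0 < normc d + 1 by have := normc_ge0 d; lra.
exists (Num.min dl (ep / (normc d + 1))); first by rewrite lt_min dl0 divr_gt0.
move=> h; rewrite lt_min => /andP[/H {}H].
by rewrite ltr_pdivlMr// => h2; apply: le_trans H _; lra.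
Qed.

Lemma cder_unique g z d1 d2 : cder g z d1 -> cder g z d2 -> d1 = d2.
Proof.
move=> H1 H2; apply/eqP; rewrite -subr_eq0; apply/eqP.
apply: (normc_small_eq0 (K := 2)) => e e0.
have [a1 a10 h1] := H1 e e0; have [a2 a20 h2] := H2 e e0.
pose c := Num.min a1 a2 / 2.
have m0 : 0 < Num.min a1 a2 by rewrite lt_min a10.
have c0 : 0 < c by rewrite divr_gt0.
have nc : normc c%:C = c by rewrite normc_real gtr0_norm.
have : c < Num.min a1 a2 by rewrite /c; lra.
rewrite lt_min -{1 2}nc => /andP[/h1 H /h2 H']; rewrite nc in H H'.
rewrite -(ler_pM2l c0) -[in X in X <= _]nc -normcM.
rewrite (_ : _ * _ = (g (z + c%:C) - g z - c%:C * d2) - (g (z + c%:C) - g z - c%:C * d1));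
  last by ring.
by apply: le_trans (normcB _ _) _; lra.
Qed.

Lemma cderD f g z d1 d2 : cder f z d1 -> cder g z d2 ->
  cder (fun x => f x + g x) z (d1 + d2).
Proof.
by move=> H1 H2; apply: littleo_ext (littleoD H1 H2) => h; ring.
Qed.

Lemma cderZ (a : R[i]) g z d : cder g z d -> cder (fun x => a * g x) z (a * d).
Proof. by move=> /(littleoZ a); apply: littleo_ext => h; ring. Qed.

Lemma cderB f g z d1 d2 : cder f z d1 -> cder g z d2 ->
  cder (fun x => f x - g x) z (d1 - d2).
Proof.
move=> H1 /(littleoZ (-1)) H2; apply: littleo_ext (littleoD H1 H2) => h; ring.
Qed.

Lemma cder_affine (a b : R[i]) z : cder (fun x => a + b * x) z b.
Proof. by apply: littleo_ext littleo0 => h; ring. Qed.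

Lemma cder_cst (a : R[i]) z : cder (fun=> a) z 0.
Proof. by apply: littleo_ext littleo0 => h; ring. Qed.

Lemma cder_sum (I : Type) (r : seq I) (F : I -> R[i] -> R[i]) (d : I -> R[i]) z :
  (forall i, cder (F i) z (d i)) ->
  cder (fun x => \sum_(i <- r) F i x) z (\sum_(i <- r) d i).
Proof.
move=> dF; elim: r => [|i r IH].
  by apply: littleo_ext littleo0 => h; rewrite !big_nil; ring.
rewrite big_cons; apply: littleo_ext (cderD (dF i) IH) => h.
by rewrite !big_cons.
Qed.

Lemma cderM f g z d1 d2 : cder f z d1 -> cder g z d2 ->
  cder (fun x => f x * g x) z (d1 * g z + f z * d2).
Proof.
move=> H1 H2.
have [dl dl0 Hg] := cder_cont H2 ltr01.
(* The error of the product is [g (z + h)] times the error of [f], plus [f z] times the error of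
   [g], plus [d1 * h] times the increment of [g]. *)
have oD1 := littleo_bounded (b := fun h => g (z + h)) (K := normc (g z) + 1) dl0 _ H1.
have oD2 := littleoZ (f z) H2.
have oD3 : littleo (fun h => (d1 * h) * (g (z + h) - g z)).
  move=> ep ep0; have K0 : 0 < normc d1 + 1 by have := normc_ge0 d1; lra.
  have [dl' dl0' H] := cder_cont H2 (divr_gt0 ep0 K0).
  exists dl' => // h /H {}H; rewrite !normcM mulrAC ler_wpM2r ?normc_ge0//.
  rewrite ler_pdivlMr// in H; apply: le_trans H.
  by have := normc_ge0 (g (z + h) - g z); lra.
apply: littleo_ext (littleoD (littleoD (oD1 _) oD2) oD3) => h; first by ring.
move=> /Hg H; have := normcD (g (z + h) - g z) (g z); rewrite subrK.
by have := normc_ge0 (g z); lra.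
Qed.

Lemma cder_comp f g z d1 d2 : cder f z d1 -> cder g (f z) d2 ->
  cder (fun x => g (f x)) z (d1 * d2).
Proof.
move=> H1 H2; have [dl dl0 Hf] := cder_lip H1.
have o1 := littleoZ d2 H1.
have K0 : 0 < normc d1 + 1 by have := normc_ge0 d1; lra.
have o2 : littleo (fun h => g (f (z + h)) - g (f z) - (f (z + h) - f z) * d2).
  move=> ep ep0; have [dl2 dl20 H] := H2 _ (divr_gt0 ep0 K0).
  exists (Num.min dl (dl2 / (normc d1 + 1))); first by rewrite lt_min dl0 divr_gt0.
  move=> h; rewrite lt_min => /andP[/Hf hf]; rewrite ltr_pdivlMr// => h2.
  have := H (f (z + h) - f z); rewrite subrKC => H'.
  apply: le_trans (H' _) _; first by apply: le_lt_trans hf _; rewrite mulrC.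
  by rewrite mulrAC ler_pdivrMr// -mulrA ler_pM2l// mulrC.
by apply: littleo_ext (littleoD o2 o1) => h; ring.
Qed.

Lemma cder_shift g z w d : cder g (z + w) d -> cder (fun x => g (x + w)) z d.
Proof. by apply: littleo_ext => h; rewrite (addrAC z h w). Qed.

Lemma cder_rder g (p w : R[i]) (t : R) d : cder g (p + t%:C * w) d ->
  rder (fun s => g (p + s%:C * w)) t (w * d).
Proof.
move=> H e e0; have K0 : 0 < normc w + 1 by have := normc_ge0 w; lra.
have [dl dl0 Hd] := H _ (divr_gt0 e0 K0).
exists (dl / (normc w + 1)); first by rewrite divr_gt0.
move=> h; rewrite ltr_pdivlMr// => hd.
rewrite rmorphD /= mulrDl addrA mulrA.
have hw : normc (h%:C * w) = `|h| * normc w by rewrite normcM normc_real.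
apply: le_trans (Hd _ _) _; first by rewrite hw; have := normr_ge0 h; lra.
rewrite hw mulrAC ler_pdivrMr// -mulrA ler_pM2l// ler_wpM2l//; lra.
Qed.

Lemma cder_mvt g (g' : R[i] -> R[i]) (z h : R[i]) (M : R) :
  (forall w, normc (w - z) <= normc h -> cder g w (g' w)) ->
  (forall w, normc (w - z) <= normc h -> normc (g' w) <= M) ->
  normc (g (z + h) - g z) <= M * normc h.
Proof.
move=> dg hM.
have in_seg (t : R) : 0 <= t <= 1 -> normc (z + t%:C * h - z) <= normc h.
  move=> t01; rewrite addrC addKr normcM normc_real ger0_norm; last by lra.
  by rewrite ler_piMl ?normc_ge0//; lra.
have := @rder_mvt R (fun t => g (z + t%:C * h)) (fun t => h * g' (z + t%:C * h))
   0 1 (M * normc h) ler01.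
rewrite mul1r mul0r addr0 subr0 mulr1; apply => t /in_seg t01.
  by apply: cder_rder; exact: dg.
by rewrite normcM mulrC ler_wpM2r ?normc_ge0// hM.
Qed.

Lemma cder0_const g : (forall z, cder g z 0) -> forall z w, g z = g w.
Proof.
move=> dg z w; apply/eqP; rewrite -subr_eq0 -normc_eq0 eq_le normc_ge0 andbT.
have := @cder_mvt g (fun=> 0) w (z - w) 0; rewrite subrKC mul0r; apply => // *.
by rewrite normc0.
Qed.

End ComplexDerivative.

(** * The complex exponential and its derivative *)

Section ComplexExponential.
Variable R : realType.
Implicit Types (z w : R[i]).

Lemma cexp0 : cexp (0 : R[i]) = 1.
Proof. by rewrite /cexp /= expR0 cos0 sin0 mulr0 mulr1. Qed.

Lemma cexpD z w : cexp (z + w) = cexp z * cexp w.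
Proof.
case: z w => [a b] [c d]; apply/eqP; rewrite eq_complex /= expRD cosD sinD.
by apply/andP; split; apply/eqP; ring.
Qed.

Lemma cexp_neq0 z : cexp z != 0.
Proof.
apply/eqP => h; have := cexpD z (- z); rewrite subrr cexp0 h mul0r => /eqP.
by rewrite oner_eq0.
Qed.

Lemma cexpN z : cexp (- z) = ((cexp z)^-1)%R.
Proof.
by apply: (mulfI (cexp_neq0 z)); rewrite -cexpD subrr cexp0 mulfV ?cexp_neq0.
Qed.

Lemma cexpM_nat z n : cexp (n%:R * z) = cexp z ^+ n.
Proof.
elim: n => [|n IH]; first by rewrite mul0r cexp0.
by rewrite exprS -IH -cexpD -natr1 mulrDl mul1r addrC.
Qed.

Lemma normc_cexp z : normc (cexp z) = expR (complex.Re z).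
Proof.
by rewrite /cexp /= !exprMn -mulrDr cos2Dsin2 mulr1 sqrtr_sqr ger0_norm ?expR_ge0//.
Qed.

Lemma cexp_periodic (t : R) : cexp (t +i* (pi *+ 2)) = cexp (t +i* 0).
Proof. by rewrite /cexp /= cos2pi sin2pi cos0 sin0. Qed.

(** The functional equation reduces differentiability to the point 0, where the real derivatives of
    [expR], [cos] and [sin] give it. *)
Lemma cexp_littleo0 : littleo (fun h : R[i] => cexp h - 1 - h).
Proof.
move=> e e0.
have lo (f : R -> R) (d : R) : is_derive (0 : R) (1 : R) f d ->
    forall ep : R, 0 < ep -> exists2 dl : R, 0 < dl &
    forall h : R, `|h| < dl -> `|f h - f 0 - h * d| <= ep * `|h|.
  move=> df ep ep0; have d0 : derivable f 0 1 by exact: ex_derive.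
  have dE : derive1 f 0 = d by rewrite derive1E; exact: derive_val.
  by have [dl dl0 H] := derive1_littleo d0 dE ep0; exists dl => // h /H; rewrite add0r.
have e8 : 0 < e / 8 by rewrite divr_gt0.
have [d1 d10 h1] := lo _ _ (is_derive_expR 0) _ e8.
have [d2 d20 h2] := lo _ _ (is_derive_cos 0) _ e8.
have [d3 d30 h3] := lo _ _ (is_derive_sin 0) _ e8.
have [d4 d40 h4] := lo _ _ (is_derive_expR 0) _ ltr01.
(* Below 1/2 the modulus of [h] keeps [expR x] at most 2; below [e / 16] it keeps [expR x - 1] at
   most [e / 8] in absolute value. *)
pose m := Num.min 1 (e / 8) / 2.
exists (Num.min (Num.min d1 d2) (Num.min (Num.min d3 d4) m)).
  by rewrite !lt_min d10 d20 d30 d40 /m divr_gt0// lt_min ltr01.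
move=> [x y]; set nz := normc _; rewrite !lt_min.
have xn : `|x| <= nz := normc_Re (x +i* y).
have yn : `|y| <= nz := normc_Im (x +i* y).
move=> /andP[/andP[l1 l2] /andP[/andP[l3 l4] lm]].
have := h1 x (le_lt_trans xn l1); have := h2 y (le_lt_trans yn l2).
have := h3 y (le_lt_trans yn l3); have := h4 x (le_lt_trans xn l4).
rewrite expR0 cos0 sin0 oppr0 !mulr0 !mulr1 !mul1r !subr0 ?addr0 => H4 H3 H2 H1.
have lm2 : nz < 1 / 2 /\ nz < e / 16.
  move: lm; rewrite /m => lm; have [h|h] := leP 1 (e / 8); move: lm;
    rewrite ?(min_l h) ?(min_r (ltW h)); lra.
have ex : `|expR x - 1| <= 2 * `|x|.
  by have := ler_normD (expR x - 1 - x) x; rewrite subrK; lra.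
have ex2 : `|expR x| <= 2.
  by have := ler_normD (expR x - 1) 1; rewrite subrK normr1; lra.
apply: le_trans (normc_ReIm _) _; rewrite /cexp /=.
have E1 : expR x * cos y - 1 - x = expR x * (cos y - 1) + (expR x - 1 - x) by ring.
have E2 : expR x * sin y - 0 - y = expR x * (sin y - y) + (expR x - 1) * y by ring.
rewrite E1 E2.
have B1 := ler_normD (expR x * (cos y - 1)) (expR x - 1 - x).
have B2 := ler_normD (expR x * (sin y - y)) ((expR x - 1) * y).
rewrite !normrM in B1 B2.
have B3 : `|expR x| * `|cos y - 1| <= 2 * (e / 8 * `|y|).
  by apply: ler_pM.
have B4 : `|expR x| * `|sin y - y| <= 2 * (e / 8 * `|y|).
  by apply: ler_pM.
have B5 : `|expR x - 1| * `|y| <= e / 8 * `|y|.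
  by apply: ler_wpM2r; [exact: normr_ge0|lra].
have e8y : e / 8 * `|y| <= e / 8 * nz by rewrite ler_pM2l.
have e8x : e / 8 * `|x| <= e / 8 * nz by rewrite ler_pM2l.
have enz : 0 <= e * nz by rewrite mulr_ge0 ?normc_ge0 ?ltW.
lra.
Qed.

Lemma cder_cexp z : cder (@cexp R) z (cexp z).
Proof.
by apply: littleo_ext (littleoZ (cexp z) cexp_littleo0) => h; rewrite cexpD; ring.
Qed.

End ComplexExponential.

(** * Goursat's theorem on rectangles and its consequence for periodic functions *)

Section Goursat.
Variable R : realType.
Variables G G' : R[i] -> R[i].
Hypothesis dG : forall z, cder G z (G' z).

Let hor (y t : R) := G (t +i* y).
Let ver (x t : R) := G (x +i* t).

Lemma hor_line (x y : R) : x +i* y = 'i%C * y%:C + x%:C * 1 :> R[i].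
Proof. by apply/eqP; rewrite eq_complex /=; apply/andP; split; apply/eqP; ring. Qed.

Lemma ver_line (x y : R) : x +i* y = x%:C + y%:C * 'i%C :> R[i].
Proof. by apply/eqP; rewrite eq_complex /=; apply/andP; split; apply/eqP; ring. Qed.

Lemma rder_hor (H : R[i] -> R[i]) (d : R[i]) (x y : R) : cder H (x +i* y) d ->
  rder (fun t => H (t +i* y)) x d.
Proof.
under eq_fun do rewrite hor_line.
by rewrite hor_line => /cder_rder; rewrite mul1r.
Qed.

Lemma rder_ver (H : R[i] -> R[i]) (d : R[i]) (x y : R) : cder H (x +i* y) d ->
  rder (fun t => H (x +i* t)) y ('i%C * d).
Proof.
under eq_fun do rewrite ver_line.
by rewrite ver_line => /cder_rder.
Qed.

Lemma rder_rcont (F : R -> R[i]) t d : rder F t d -> rcont F t.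
Proof.
move=> H e e0; have [dl dl0 h1] := H 1 ltr01.
have K0 : 0 < normc d + 1 by have := normc_ge0 d; lra.
exists (Num.min dl (e / (normc d + 1))); first by rewrite lt_min dl0 divr_gt0.
move=> h; rewrite lt_min => /andP[/h1 hh]; rewrite ltr_pdivlMr// => he.
have := normcD (F (t + h) - F t - h%:C * d) (h%:C * d).
by rewrite subrK normcM normc_real; lra.
Qed.

Let chor y t : rcont (hor y) t. Proof. exact: rder_rcont (rder_hor (dG _)). Qed.
Let cver x t : rcont (ver x) t. Proof. exact: rder_rcont (rder_ver (dG _)). Qed.

(** Integrals of [G dz] along horizontal and vertical segments. Primitives based at -1 are valid at
    all nonnegative coordinates, whence the conditions [0 <= x] and [0 <= y] below. *)
Let Hint y a b := prim (-1) (hor y) b - prim (-1) (hor y) a.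
Let Vint x a b := 'i%C * (prim (-1) (ver x) b - prim (-1) (ver x) a).

(** The integral of [G dz] along the boundary of the rectangle, counterclockwise. *)
Let Iloop x y a b := Hint y x (x + a) + Vint (x + a) y (y + b)
  - Hint (y + b) x (x + a) - Vint x y (y + b).

(** Near [Z] the function [G] is within [ep / 4 * (a + b)] of its affine approximation [A]. As [A]
    has the primitive [H], its boundary integral vanishes; the error is integrated over the
    perimeter [2 * (a + b)]. *)
Lemma Iloop_local (X Y : R) (ep : R) : 0 < ep -> exists2 d : R, 0 < d &
  forall x y a b, x <= X <= x + a -> y <= Y <= y + b ->
    0 <= a < d -> 0 <= b < d -> 0 <= x -> 0 <= y ->
    normc (Iloop x y a b) <= ep * (a ^+ 2 + b ^+ 2).
Proof.
move=> ep0; set Z := X +i* Y.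
have ep4 : 0 < ep / 4 by rewrite divr_gt0.
have [dl dl0 Hd] := dG Z ep4.
exists (dl / 2); first by rewrite divr_gt0.
move=> x y a b xX yY /andP[a0 ad] /andP[b0 bd] x0 y0.
pose A z := G Z + (z - Z) * G' Z.
pose H z := G Z * z + G' Z * ((z - Z) * (z - Z) / 2).
have dH z : cder H z (A z).
  have -> : A z = G Z * 1 + G' Z * (1 / 2 * (z - Z) + (1 / 2 * z - Z / 2) * 1) by rewrite /A; field.
  have c1 : cder (fun z => z) z 1.
    by have := cder_affine 0 1 z; under eq_fun do rewrite add0r mul1r.
  have c2 : cder (fun z => z - Z) z 1.
    by have := cder_affine (- Z) 1 z; under eq_fun do rewrite addrC mul1r.
  have c3 : cder (fun z => 1 / 2 * z - Z / 2) z (1 / 2).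
    by have := cder_affine (- (Z / 2)) (1 / 2) z; under eq_fun do rewrite addrC.
  have := cderD (cderZ (G Z) c1) (cderZ (G' Z) (cderM c3 c2)).
  by apply: littleo_ext => h; rewrite /H; field.
have close s t : x <= s <= x + a -> y <= t <= y + b ->
    normc (G (s +i* t) - A (s +i* t)) <= ep / 4 * (a + b).
  move=> hs ht; set k := s +i* t - Z.
  have kE : s +i* t = Z + k by rewrite /k subrKC.
  have nk : normc k <= a + b.
    have -> : k = (s - X) +i* (t - Y) by [].
    apply: le_trans (normc_ReIm _) _ => /=; apply: lerD.
      by rewrite ler_norml; apply/andP; split; lra.
    by rewrite ler_norml; apply/andP; split; lra.
  rewrite kE (_ : _ - _ = G (Z + k) - G Z - k * G' Z); last by rewrite /A; ring.
  apply: le_trans (Hd _ _) _; first by lra.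
  by rewrite ler_pM2l.
have approxH t : y <= t <= y + b ->
    normc (Hint t x (x + a) - (H ((x + a) +i* t) - H (x +i* t))) <= ep / 4 * (a + b) * a.
  move=> ht; have -> : ep / 4 * (a + b) * a = ep / 4 * (a + b) * (x + a - x) by ring.
  apply: (prim_approx (G := fun s => H (s +i* t)) (G' := fun s => A (s +i* t))).
  - exact: chor.
  - lra.
  - lra.
  - by move=> s _; exact: rder_hor.
  - by move=> s hs; exact: close.
have approxV s : x <= s <= x + a ->
    normc (Vint s y (y + b) - (H (s +i* (y + b)) - H (s +i* y))) <= ep / 4 * (a + b) * b.
  move=> hs; have -> : ep / 4 * (a + b) * b = ep / 4 * (a + b) * (y + b - y) by ring.
  (* Along a vertical line the derivative of [H] is ['i * A], so the primitive of [A] there is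
     [- 'i * H]. *)
  have i2 : 'i%C * - 'i%C = 1 :> R[i] by rewrite mulrN -expr2 sqr_i opprK.
  rewrite (_ : _ - _ = 'i%C * (prim (-1) (ver s) (y + b) - prim (-1) (ver s) y -
      (- 'i%C * H (s +i* (y + b)) - (- 'i%C) * H (s +i* y)))); last first.
    rewrite /Vint; set D := H _ - H _; rewrite -[D]mul1r -i2 /D; ring.
  rewrite normcM normc_i mul1r.
  apply: (prim_approx (G := fun t => - 'i%C * H (s +i* t)) (G' := fun t => A (s +i* t))).
  - exact: cver.
  - lra.
  - lra.
  - move=> t _; have := rder_ver (cderZ (- 'i%C) (dH (s +i* t))).
    by rewrite mulrA i2 mul1r.
  - by move=> t ht; exact: close.
have ya : y <= y <= y + b by lra.
have yb : y <= y + b <= y + b by lra.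
have xa : x <= x <= x + a by lra.
have xb : x <= x + a <= x + a by lra.
have := approxH _ ya; have := approxH _ yb.
have := approxV _ xa; have := approxV _ xb.
rewrite /Iloop.
set V2 := Vint (x + a) _ _; set V1 := Vint x _ _.
set H1 := Hint y _ _; set H2 := Hint (y + b) _ _.
set h11 := H ((x + a) +i* (y + b)); set h00 := H (x +i* y).
set h10 := H ((x + a) +i* y); set h01 := H (x +i* (y + b)).
move=> B1 B2 B3 B4.
rewrite (_ : _ - V1 = (H1 - (h10 - h00)) + (V2 - (h11 - h10)) - (H2 - (h11 - h01))
   - (V1 - (h01 - h00))); last by ring.
apply: le_trans (normcB _ _) _; apply: le_trans (lerD (normcB _ _) (lexx _)) _.
apply: le_trans (lerD (lerD (normcD _ _) (lexx _)) (lexx _)) _.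
have sq := sqr_ge0 (a - b).
have sqm : ep * (a + b) ^+ 2 <= ep * (2 * (a ^+ 2 + b ^+ 2)) by rewrite ler_pM2l//; nra.
lra.
Qed.

(** The bound [ep * (a ^ 2 + b ^ 2)] is exactly compatible with subdivision: each of the four
    quarters contributes a quarter of it, and the inner sides cancel. *)
Lemma goursat a b : 0 <= a -> 0 <= b -> Iloop 0 0 a b = 0.
Proof.
move=> a0 b0; apply: (normc_small_eq0 (K := a ^+ 2 + b ^+ 2)) => ep ep0.
rewrite mulrC.
pose P x y a b := 0 <= x -> 0 <= y -> normc (Iloop x y a b) <= ep * (a ^+ 2 + b ^+ 2).
suff : P 0 0 a b by apply.
apply: (@rectangle_bisection R P) => //; last first.
  move=> X Y; have [d d0 Hd] := Iloop_local X Y ep0; exists d => //.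
move=> x y w h w0 h0 P1 P2 P3 P4 x0 y0.
have {}P1 := P1 x0 y0.
have xw : 0 <= x + w / 2 by lra.
have yh : 0 <= y + h / 2 by lra.
have {}P2 := P2 xw y0.
have {}P3 := P3 x0 yh.
have {}P4 := P4 xw yh.
have hw : x + w = x + w / 2 + w / 2 by lra.
have hh : y + h = y + h / 2 + h / 2 by lra.
rewrite (_ : Iloop x y w h = Iloop x y (w / 2) (h / 2) + Iloop (x + w / 2) y (w / 2) (h / 2)
  + Iloop x (y + h / 2) (w / 2) (h / 2) + Iloop (x + w / 2) (y + h / 2) (w / 2) (h / 2)).
  apply: le_trans (normcD _ _) _; apply: le_trans (lerD (normcD _ _) (lexx _)) _.
  apply: le_trans (lerD (lerD (normcD _ _) (lexx _)) (lexx _)) _.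
  lra.
by rewrite /Iloop /Hint /Vint -hw -hh; ring.
Qed.

(** By periodicity the horizontal sides cancel in Goursat's theorem. *)
Lemma vertical_integral_periodic a b : 0 <= a -> 0 <= b ->
  (forall t, G (t +i* b) = G (t +i* 0)) ->
  prim (-1) (ver a) b - prim (-1) (ver a) 0 = prim (-1) (ver 0) b - prim (-1) (ver 0) 0.
Proof.
move=> a0 b0 per; have := goursat a0 b0; rewrite /Iloop /Hint !add0r.
have -> : hor b = hor 0 by apply/funext => t; exact: per.
move=> H; have i0 : 'i%C != 0 :> R[i].
  by apply/eqP => /(congr1 (@normc R)); rewrite normc_i normc0 => /eqP; rewrite oner_eq0.
apply: (mulfI i0); apply/eqP; rewrite -subr_eq0; apply/eqP; apply: etrans H; rewrite /Vint.
by ring.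
Qed.

(** The mean over a vertical period is the same at abscissas [a] and 0; it has modulus at most [M]
    at the first and is within [ep] of [L] at the second. *)
Lemma vertical_mean_le a b M (L : R[i]) ep : 0 <= a -> 0 < b ->
  (forall t, G (t +i* b) = G (t +i* 0)) ->
  (forall t, normc (G (a +i* t)) <= M) ->
  (forall t, normc (G (0 +i* t) - L) <= ep) ->
  normc L <= M + ep.
Proof.
move=> a0 b0 per hM hL; have := vertical_integral_periodic a0 (ltW b0) per.
have N10 : -1 < 0 :> R by lra.
have h1 : normc (prim (-1) (ver a) b - prim (-1) (ver a) 0) <= M * b.
  have d0 (t : R) : rder (fun=> 0 : R[i]) t 0.
    by move=> e e0; exists 1 => // h _; rewrite mulr0 !subr0 normc0 mulr_ge0// ltW.
  have := prim_approx (a := -1) (M := M) (cver a) N10 (ltW b0) (fun t _ => d0 t).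
  by rewrite !subr0; apply => t _; rewrite subr0; exact: hM.
have h2 : normc (prim (-1) (ver 0) b - prim (-1) (ver 0) 0 - b%:C * L) <= ep * b.
  have d0 (t : R) : rder (fun t => 0 + t%:C * L) t L.
    have := @cder_rder R (fun z => z) 0 L t 1; rewrite mulr1; apply.
    by have := cder_affine 0 1 (0 + t%:C * L); under eq_fun do rewrite add0r mul1r.
  have := prim_approx (a := -1) (M := ep) (cver 0) N10 (ltW b0) (fun t _ => d0 t).
  by rewrite !add0r !mul0r !subr0; apply => t _; exact: hL.
move=> E; rewrite -E in h2; rewrite -(ler_pM2r b0).
have := normcB (prim (-1) (ver a) b - prim (-1) (ver a) 0)
  (prim (-1) (ver a) b - prim (-1) (ver a) 0 - b%:C * L).
by rewrite opprB subrKC normcM normc_real gtr0_norm//; lra.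
Qed.

End Goursat.

(** * Cauchy's estimate for the first derivative *)

Section CauchyEstimate.
Variable R : realType.
Variables (g g' : R[i] -> R[i]).
Hypothesis dg : forall z, cder g z (g' z).

(* In the coordinate [w = log (z - p)], the difference quotient of [g] at [p]
   becomes a [2 pi i]-periodic function that tends to [g' p] as
   [Re w --> -oo]; by Goursat's theorem its mean over a vertical period does not
   depend on [Re w]. *)
Lemma cauchy_estimate (p : R[i]) (r M : R) : 0 < r ->
  (forall z, normc (z - p) <= r -> normc (g z) <= M) ->
  normc (g' p) <= 2 * M / r.
Proof.
move=> r0 hM; apply/ler_addgt0Pr => ep ep0.
have [dl dl0 Hd] := dg p ep0.
pose m := Num.min r dl / 2.
have m00 : 0 < Num.min r dl by rewrite lt_min r0.
have m0 : 0 < m by rewrite divr_gt0.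
have : m < Num.min r dl by rewrite /m; lra.
rewrite lt_min => /andP[mr mdl].
(* The shift by [ln m] sends the line [Re w = 0] to the circle of radius [m] about [p], where the
   difference quotient is within [ep] of [g' p]. *)
pose s : R[i] := (ln m)%:C.
pose k (w : R[i]) : R[i] := cexp (w + s).
have nk x y : normc (k (x +i* y)) = expR x * m.
  by rewrite normc_cexp /= expRD lnK.
have k0 w : k w != 0 by exact: cexp_neq0.
have dk w : cder k w (k w) by apply: cder_shift; exact: cder_cexp.
pose G w := (g (p + k w) - g p) * cexp (- (w + s)).
have GE w : G w * k w = g (p + k w) - g p.
  by rewrite /G cexpN mulfVK// k0.
have dG w : exists d, cder G w d.
  eexists; apply: cderM; last first.
    have := @cder_comp R (fun w => - s + (-1) * w) (@cexp R) w (-1) (cexp (- (w + s)))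
      (cder_affine _ _ _).
    under eq_fun do rewrite mulN1r -opprD (addrC s).
    by apply; rewrite mulN1r -opprD (addrC s); exact: cder_cexp.
  apply: cderB (cder_cst _ _).
  apply: (@cder_comp R (fun w => p + k w) g w); last exact: dg.
  exact: cderD (cder_cst p w) (dk w).
(* Only the existence of a derivative of [G] matters, so it is chosen rather than computed. *)
pose G' w := sval (cid (dG w)).
(* The abscissa [a] defined next corresponds to the circle of radius [r], where both values in the
   difference quotient are at most [M]: hence the bound [2 * M / r]. *)
have dG' w : cder G w (G' w) by exact: svalP (cid (dG w)).
pose a := ln (r / m).
have a0 : 0 <= a by rewrite ln_ge0// ler_pdivlMr// mul1r ltW.
have ea : expR a * m = r by rewrite lnK ?divfK ?gt_eqF// posrE divr_gt0.
apply: (vertical_mean_le dG' (a := a) (b := pi *+ 2)) => //.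
- by rewrite mulrn_wgt0// pi_gt0.
- move=> t; apply: (mulIf (k0 (t +i* 0))).
  have kE : k (t +i* (pi *+ 2)) = k (t +i* 0).
    rewrite /k (_ : t +i* (pi *+ 2) + s = (t + ln m) +i* (pi *+ 2)); last first.
      by rewrite /s; congr (_ +i* _); rewrite addr0.
    rewrite (_ : t +i* 0 + s = (t + ln m) +i* 0); first exact: cexp_periodic.
    by rewrite /s; congr (_ +i* _); rewrite addr0.
  by rewrite GE -kE GE.
- move=> t; rewrite ler_pdivlMr// -ea -(nk a t) -normcM GE.
  apply: le_trans (normcB _ _) _.
  have h1 : normc (g (p + k (a +i* t))) <= M.
    by apply: hM; rewrite addrC addKr nk ea.
  have h2 : normc (g p) <= M by apply: hM; rewrite subrr normc0 ltW.
  lra.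
- move=> t; have nk0 : 0 < normc (k (0 +i* t)) by rewrite normc_gt0.
  rewrite -(ler_pM2r nk0) -normcM mulrBl GE [_ * k _]mulrC.
  by apply: Hd; rewrite nk expR0 mul1r.
Qed.

End CauchyEstimate.

(** * Limits at a point and a second-order Taylor bound *)

Section CauchyConsequences.
Variable R : realType.
Implicit Types (g : R[i] -> R[i]).

(** Every lower bound [q s - K * normc s] is at most every upper bound [q t + K * normc t], so the
    supremum of the former is the limit. *)
Lemma real_cauchy_limit (q : R[i] -> R) (r K : R) : 0 < r ->
  (forall s t, s != 0 -> t != 0 -> normc s <= r -> normc t <= r ->
     `|q s - q t| <= K * (normc s + normc t)) ->
  exists L, forall s, s != 0 -> normc s <= r -> `|q s - L| <= K * normc s.
Proof.
move=> r0 H; pose A := [set x | exists s : R[i], [/\ s != 0, normc s <= r &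
  x = q s - K * normc s]]%classic.
have ubA t : t != 0 -> normc t <= r -> ubound A (q t + K * normc t).
  move=> t0 tr _ [s [s0 sr ->]]; have := H s t s0 t0 sr tr.
  by move=> /ler_normlP[_]; lra.
exists (sup A) => t t0 tr.
have At : A (q t - K * normc t) by exists t.
have h1 : q t - K * normc t <= sup A.
  by apply: ub_le_sup => //; exists (q t + K * normc t); exact: ubA.
have h2 : sup A <= q t + K * normc t.
  by apply: ge_sup; [exists (q t - K * normc t)|exact: ubA].
by apply/ler_normlP; split; lra.
Qed.

Lemma cauchy_limit (q : R[i] -> R[i]) (r K : R) : 0 < r ->
  (forall s t, s != 0 -> t != 0 -> normc s <= r -> normc t <= r ->
     normc (q s - q t) <= K * (normc s + normc t)) ->
  exists L, forall s, s != 0 -> normc s <= r -> normc (q s - L) <= 2 * K * normc s.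
Proof.
move=> r0 H.
have [s t s0 t0 sr tr|a ha] := @real_cauchy_limit (fun s => complex.Re (q s)) r K r0.
  by rewrite -ReB; apply: le_trans (normc_Re _) _; exact: H.
have [s t s0 t0 sr tr|b hb] := @real_cauchy_limit (fun s => complex.Im (q s)) r K r0.
  by rewrite -ImB; apply: le_trans (normc_Im _) _; exact: H.
exists (a +i* b) => s s0 sr; apply: le_trans (normc_ReIm _) _.
by rewrite ReB ImB /=; have := ha s s0 sr; have := hb s s0 sr; lra.
Qed.

(** Cauchy's estimate bounds [g'], hence the increments of [g]; applied to such an increment, it
    bounds those of [g']. The mean value inequality for [g z - g' p * z] concludes. The radius
    shrinks from [4 * r] by [r] at each stage. *)
Lemma cauchy_taylor g g' (p h : R[i]) (r M : R) : 0 < r ->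
  (forall z, cder g z (g' z)) ->
  (forall z, normc (z - p) <= 4 * r -> normc (g z) <= M) ->
  normc h <= r ->
  normc (g (p + h) - g p - h * g' p) <= 4 * M / r ^+ 2 * normc h ^+ 2.
Proof.
move=> r0 dg hM hr.
have tri (x y z : R[i]) (a b : R) : normc (x - y) <= a -> normc (y - z) <= b ->
    normc (x - z) <= a + b.
  by move=> ? ?; apply: le_trans (normc_distD y _ _) _; exact: lerD.
have B1 z : normc (z - p) <= 3 * r -> normc (g' z) <= 2 * M / r.
  move=> hz; apply: cauchy_estimate => // w hw; apply: hM.
  by have := tri _ _ _ _ _ hw hz; lra.
have M0 : 0 <= M.
  by apply: le_trans (hM p _); rewrite ?normc_ge0// subrr normc0; lra.
have B2 k z : normc k <= r -> normc (z - p) <= 2 * r ->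
    normc (g (z + k) - g z) <= 2 * M / r * normc k.
  move=> kr hz; apply: (cder_mvt (g' := g')) => // w hw; apply: B1.
  by have := tri _ _ _ _ _ hw hz; lra.
have B3 k : normc k <= r -> normc (g' (p + k) - g' p) <= 4 * M / r ^+ 2 * normc k.
  move=> kr; have -> : 4 * M / r ^+ 2 * normc k = 2 * (2 * M / r * normc k) / r.
    by field; rewrite gt_eqF.
  apply: (@cauchy_estimate R (fun z => g (z + k) - g z) (fun z => g' (z + k) - g' z)) => //.
    by move=> w; apply: cderB => //; exact: cder_shift.
  by move=> w hw; apply: B2 => //; lra.
have := @cder_mvt R (fun z => g z - g' p * z) (fun z => g' z - g' p) p h
  (4 * M / r ^+ 2 * normc h).
rewrite (_ : g (p + h) - _ - _ = g (p + h) - g p - h * g' p); last by ring.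
rewrite (_ : 4 * M / r ^+ 2 * normc h * normc h = 4 * M / r ^+ 2 * normc h ^+ 2); last by ring.
apply => w hw.
  apply: cderB => //; have := cder_affine 0 (g' p) w.
  by under eq_fun do rewrite add0r.
have := B3 (w - p); rewrite subrKC => H; apply: le_trans (H _) _; first by lra.
by rewrite ler_wpM2l// !mulr_ge0// invr_ge0 exprn_ge0// ltW.
Qed.

End CauchyConsequences.

(** * Iterated directional derivatives of entire functions of several variables *)

Section DirectionalDerivative.
Local Open Scope classical_set_scope.
Variables (R : realType) (m : nat).
Implicit Types (f : 'rV[R[i]]_m -> R[i]) (u v z w : 'rV[R[i]]_m).

Definition ddir f v z (d : R[i]) := cder (fun t => f (z + t *: v)) 0 d.

(** With the next but one lemma, the passage between real epsilons and the library's complex-valued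
    norm: a positive element of [R[i]] is the image of its real part. *)
Lemma ddir_derive f v z d : ddir f v z d ->
  'D_(v : 'rV[CC R]_m) (f : 'rV[CC R]_m -> CC R) z = d.
Proof.
move=> H; apply/cvg_lim; first exact: norm_hausdorff.
apply/cvgrPdist_le => e e0.
have e0R : 0 < complex.Re e by move: e0; rewrite ltcE => /andP[].
have eE : e = (complex.Re e)%:C.
  by rewrite RRe_real// realE ltW.
have [dl dl0 Hd] := H _ e0R.
have dlC : (0 : CC R) < dl%:C by rewrite -[0]/(0%:C) ltcR.
apply/nbhs_ballP; exists dl%:C => //= h.
rewrite /ball /= sub0r normrN => hdl h0.
rewrite eE -[`|_|]/((normc _)%:C) lecR.
have hn : normc (h : R[i]) < dl by move: hdl; rewrite -[`|_|]/((normc _)%:C) ltcR.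
have hpos : 0 < normc (h : R[i]) by rewrite normc_gt0.
rewrite -(ler_pM2l hpos) -normcM mulrC [leRHS]mulrC.
have := Hd _ hn; rewrite !add0r scale0r addr0 => Hh.
rewrite -normcNE mulrC [h *: v + z]addrC.
have -> : - ((h : R[i]) * (d - (h^-1 : R[i]) *: (f (z + h *: v) - f z))) =
    f (z + h *: v) - f z - h * d.
  have h0' : (h : R[i]) != 0 by [].
  rewrite /GRing.scale /=; field.
  exact: h0'.
exact: Hh.
Qed.

Lemma derivable_ddir f v z : derivable (f : 'rV[CC R]_m -> CC R) z (v : 'rV[CC R]_m) ->
  ddir f v z ('D_(v : 'rV[CC R]_m) (f : 'rV[CC R]_m -> CC R) z).
Proof.
move=> df e e0.
have eC : (0 : CC R) < e%:C by rewrite -[0]/(0%:C) ltcR.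
have /cvgrPdist_le /(_ _ eC) := (df : _ --> _).
set d := lim _; have -> : 'D_(v : 'rV[CC R]_m) (f : 'rV[CC R]_m -> CC R) z = d by [].
move=> /nbhs_ballP[dl /= dl0 H].
have dlE : dl = (complex.Re dl)%:C by rewrite RRe_real// realE ltW.
exists (complex.Re dl); first by move: dl0; rewrite ltcE => /andP[].
move=> h hdl; rewrite !add0r scale0r addr0.
have [->|h0] := eqVneq h 0.
  by rewrite scale0r addr0 subrr mul0r subrr !normc0 mulr0.
have := H h; rewrite /ball /= sub0r normrN dlE -[`|_|]/((normc _)%:C) ltcR.
move=> /(_ hdl h0); rewrite -[`|_|]/((normc _)%:C) lecR => H'.
have hpos : 0 < normc (h : R[i]) by rewrite normc_gt0.
move: H'; rewrite -(ler_pM2l hpos) -normcM [leRHS]mulrC [h *: v + z]addrC.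
rewrite -normcNE; congr (normc _ <= _).
by rewrite /GRing.scale /=; field.
Qed.

Definition box z (r : R) w := forall j, normc (w 0 j - z 0 j) <= r.

Definition near_bounded f z := exists2 r : R, 0 < r &
  exists M : R, forall w, box z r w -> normc (f w) <= M.

Lemma continuous_near_bounded f z :
  {for z, continuous (f : 'rV[CC R]_m -> CC R)} -> near_bounded f z.
Proof.
move=> /cvgrPdist_le /(_ 1 ltr01) /nbhs_ballP[dl /= dl0 H].
have dlE : dl = (complex.Re dl)%:C by rewrite RRe_real// realE ltW.
have dlr : 0 < complex.Re dl by move: dl0; rewrite ltcE => /andP[].
exists (complex.Re dl / 2); first by rewrite divr_gt0.
exists (normc (f z) + 1) => w hw.
have : `|(f z : CC R) - f w| <= 1.
  apply: H; split => // i j; rewrite ord1 dlE.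
  rewrite /ball /= -[`|_|]/((normc _)%:C) ltcR normc_distC.
  by apply: le_lt_trans (hw j) _; lra.
rewrite -[`|_|]/((normc _)%:C) -[1]/(1%:C) lecR => h.
by have := normcB (f z) (f z - f w); rewrite subKr; lra.
Qed.

Definition dD f v z : R[i] := 'D_(v : 'rV[CC R]_m) (f : 'rV[CC R]_m -> CC R) z.

(* Unlike Frechet differentiability, these properties pass from [f] to its
   directional derivatives by one-variable Cauchy estimates alone. *)
Definition line_holomorphic f := [/\ forall z, near_bounded f z,
  forall z v, ddir f v z (dD f v z) &
  forall z v, dD f v z = \sum_j v 0 j * dD f (delta_mx 0 j) z].

Lemma entire_line_holomorphic f : entire f -> line_holomorphic f.
Proof.
move=> ef; split=> [z|z v|z v].
- by apply: continuous_near_bounded; exact: differentiable_continuous (ef z).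
- by apply: derivable_ddir; exact: diff_derivable (ef z).
- rewrite /dD deriveE; last exact: ef.
  rewrite [in LHS](row_sum_delta v) linear_sum; apply: eq_bigr => j _.
  by rewrite linearZ deriveE//; exact: ef.
Qed.

Lemma dirder_dD f u : line_holomorphic f -> dirder u f = dD f u.
Proof. by move=> [_ _ lin]; apply/funext => z; rewrite lin. Qed.

Lemma ddir_line f w v t d : ddir f v (w + t *: v) d ->
  cder (fun s => f (w + s *: v)) t d.
Proof.
apply: littleo_ext => h; rewrite add0r scale0r addr0; congr (f _ - f _ - _).
by rewrite scalerDl addrA.
Qed.

(** Bounds every coordinate of [v]; the added 1 makes it a safe denominator. *)
Let vsize v := \sum_j normc (v 0 j) + 1.

Lemma vsize_gt0 v : 0 < vsize v.
Proof. by rewrite ltr_wpDl// sumr_ge0// => j _; exact: normc_ge0. Qed.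

Lemma box_shift z r s w v (t : R[i]) : box z r w -> normc t * vsize v <= s ->
  box z (r + s) (w + t *: v).
Proof.
move=> hw ht j; rewrite !mxE addrAC; apply: le_trans (normcD _ _) _.
apply: lerD => //; rewrite normcM; apply: le_trans ht.
rewrite ler_wpM2l ?normc_ge0// /vsize (bigD1 j)//=.
have : 0 <= \sum_(i < m | i != j) normc (v 0 i).
  by apply: sumr_ge0 => i _; exact: normc_ge0.
lra.
Qed.

Lemma box_weaken z r s w : r <= s -> box z r w -> box z s w.
Proof. by move=> rs hw j; exact: le_trans rs. Qed.

Lemma box_center z r : 0 <= r -> box z r z.
Proof. by move=> r0 j; rewrite subrr normc0. Qed.

Lemma near_diffquot f z v : line_holomorphic f -> exists2 r : R, 0 < r &
  exists K : R, forall w s, box z r w -> normc s <= r ->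
    normc (f (w + s *: v) - f w - s * dD f v w) <= K * normc s ^+ 2.
Proof.
move=> [bf df _]; have [r r0 [M hM]] := bf z.
have v0 := vsize_gt0 v.
(* [cauchy_taylor] uses the disc of radius [4 * q], on which [t *: v] moves each coordinate by at
   most [r / 2]. *)
pose q := r / (8 * vsize v).
have q0 : 0 < q by rewrite divr_gt0// mulr_gt0.
exists (Num.min (r / 2) q); first by rewrite lt_min q0 divr_gt0.
exists (4 * M / q ^+ 2) => w s hw; rewrite le_min => /andP[_ sq].
have := @cauchy_taylor R (fun t => f (w + t *: v)) (fun t => dD f v (w + t *: v))
  0 s q M q0.
rewrite add0r scale0r addr0; apply => //.
  by move=> t; apply: ddir_line.
move=> t; rewrite subr0 => ht; apply: hM; rewrite [r]splitr.
apply: box_shift; first by apply: box_weaken hw; rewrite ge_min lexx.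
apply: le_trans (ler_wpM2r (ltW v0) ht) _.
by rewrite /q le_eqVlt; apply/orP; left; apply/eqP; field; rewrite gt_eqF.
Qed.

Lemma dD_near_bounded f u z : line_holomorphic f -> near_bounded (dD f u) z.
Proof.
move=> [bf df _]; have [r r0 [M hM]] := bf z.
have u0 := vsize_gt0 u.
pose q := r / (2 * vsize u).
have q0 : 0 < q by rewrite divr_gt0// mulr_gt0.
exists (r / 2); first by rewrite divr_gt0.
exists (2 * M / q) => w hw.
have := @cauchy_estimate R (fun t => f (w + t *: u)) (fun t => dD f u (w + t *: u)).
move=> /(_ (fun t => ddir_line (df _ _)) 0 q M q0); rewrite scale0r addr0; apply.
move=> t; rewrite subr0 => ht; apply: hM; rewrite [r]splitr.
apply: box_shift => //; apply: le_trans (ler_wpM2r (ltW u0) ht) _.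
by rewrite /q le_eqVlt; apply/orP; left; apply/eqP; field; rewrite gt_eqF.
Qed.

Lemma diffquot_cder f u v w s t : line_holomorphic f -> s != 0 ->
  cder (fun t => s^-1 * (f (w + t *: u + s *: v) - f (w + t *: u))) t
    (s^-1 * (dD f u (w + t *: u + s *: v) - dD f u (w + t *: u))).
Proof.
move=> [_ df _] s0; apply: cderZ; apply: cderB; last exact: ddir_line.
have -> : (fun x => f (w + x *: u + s *: v)) = (fun x => f (w + s *: v + x *: u)).
  by apply/funext => x; rewrite addrAC.
by apply: ddir_line; rewrite (addrAC w).
Qed.

(** The difference quotients in direction [v] converge uniformly along a short piece of the line in
    direction [u], as needed to apply Cauchy's estimate in [t]. *)
Lemma diffquot_close f u v z : line_holomorphic f -> exists2 r : R, 0 < r &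
  exists K : R, forall s t, s != 0 -> normc s <= r -> normc t <= r ->
    normc (s^-1 * (f (z + t *: u + s *: v) - f (z + t *: u)) - dD f v (z + t *: u))
      <= K * normc s.
Proof.
move=> nf; have [r r0 [K hK]] := near_diffquot z v nf.
have u0 := vsize_gt0 u.
exists (Num.min r (r / vsize u)); first by rewrite lt_min r0 divr_gt0.
exists K => s t s0; rewrite !le_min => /andP[sr _] /andP[_].
rewrite ler_pdivlMr// => tr.
have hw : box z r (z + t *: u).
  by rewrite -[r]add0r; apply: box_shift => //; exact: box_center.
have ns0 : 0 < normc s by rewrite normc_gt0.
rewrite -(ler_pM2l ns0) -normcM mulrBr mulVKf//.
rewrite (_ : normc s * (K * normc s) = K * normc s ^+ 2); last by ring.
exact: hK.
Qed.

(** [Q s] is the derivative along [u] of the difference quotient of [f] along [v]. Two such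
    quotients are uniformly close for small steps, so by Cauchy's estimate the values of [Q] are
    close too, and [Q] has a limit. *)
Lemma ddir_dD_ex f u v z : line_holomorphic f -> exists d, ddir (dD f u) v z d.
Proof.
move=> nf; have [q q0 [K psi]] := diffquot_close u v z nf.
pose Q s := s^-1 * (dD f u (z + s *: v) - dD f u z).
have [s t s0 t0 sr tr|L hL] := @cauchy_limit R Q q (2 * K / q) q0.
  have := @cauchy_estimate R _ _ (fun x => cderB (diffquot_cder u v z x nf s0)
    (diffquot_cder u v z x nf t0)) 0 q (K * normc s + K * normc t) q0.
  rewrite !scale0r !addr0 => H.
  have -> : 2 * K / q * (normc s + normc t) = 2 * (K * normc s + K * normc t) / q by ring.
  apply: H => x; rewrite subr0 => xq.
  apply: le_trans (normc_distD (dD f v (z + x *: u)) _ _) _.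
  by apply: lerD; [|rewrite normc_distC]; exact: psi.
exists L => e e0; set K2 := 2 * (2 * K / q) in hL.
have K0 : 0 < `|K2| + 1 by rewrite ltr_pwDr.
exists (Num.min q (e / (`|K2| + 1))); first by rewrite lt_min q0 divr_gt0.
move=> h; rewrite lt_min => /andP[/ltW hr]; rewrite ltr_pdivlMr// => he.
rewrite add0r scale0r addr0.
have [->|h0] := eqVneq h 0.
  by rewrite scale0r addr0 subrr mul0r subr0 !normc0 mulr0.
have := hL h h0 hr; have nh0 : 0 < normc h by rewrite normc_gt0.
rewrite -(ler_pM2l nh0) -normcM mulrBr mulVKf// => /le_trans; apply.
rewrite [leRHS]mulrC ler_pM2l//; have := ler_norm K2; nra.
Qed.

Lemma dD_ddir f u v z : line_holomorphic f -> ddir (dD f u) v z (dD (dD f u) v z).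
Proof.
by move=> nf; have [d hd] := ddir_dD_ex u v z nf; rewrite [dD (dD _ _) _ _](ddir_derive hd).
Qed.

(** The derivative along [u] of the difference quotient in direction [v] is close to the left side
    by definition, and to the right side by Cauchy's estimate. *)
Lemma dD_comm f u v z : line_holomorphic f -> dD (dD f u) v z = dD (dD f v) u z.
Proof.
move=> nf; have [q q0 [K psi]] := diffquot_close u v z nf.
apply/eqP; rewrite -subr_eq0; apply/eqP.
apply: (normc_small_eq0 (K := 1 + `|2 * K / q|)) => e e0.
have [d d0 Hd] := dD_ddir u v z nf e0.
pose a := Num.min (Num.min q d) e / 2.
have m0 : 0 < Num.min (Num.min q d) e by rewrite !lt_min q0 d0.
have a0 : 0 < a by rewrite divr_gt0.
have : a < Num.min (Num.min q d) e by rewrite /a; lra.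
rewrite !lt_min => /andP[/andP[aq ad] ae].
clearbody a.
have na : normc a%:C = a by rewrite normc_real gtr0_norm.
have aC0 : a%:C != 0 by rewrite -normc_eq0 na gt_eqF.
have := Hd a%:C; rewrite na add0r scale0r addr0 => /(_ ad) H1.
have {}H1 : normc (a%:C^-1 * (dD f u (z + a%:C *: v) - dD f u z) - dD (dD f u) v z) <= e.
  rewrite -(ler_pM2l a0) -[X in X * normc _]na -normcM mulrBr mulVKf//.
  by rewrite [leRHS]mulrC.
have psia x : normc (x - 0) <= q ->
    normc (a%:C^-1 * (f (z + x *: u + a%:C *: v) - f (z + x *: u)) - dD f v (z + x *: u))
      <= K * a.
  rewrite subr0 => xq; have := psi a%:C x aC0; rewrite na; apply => //.
  exact: ltW.
have H2 := cauchy_estimate (fun x => cderB (diffquot_cder u v z x nf aC0)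
    (ddir_line (dD_ddir v u (z + x *: u) nf))) q0 psia.
rewrite !scale0r !addr0 in H2.
have := normc_distD (a%:C^-1 * (dD f u (z + a%:C *: v) - dD f u z))
  (dD (dD f u) v z) (dD (dD f v) u z).
rewrite (normc_distC _ (a%:C^-1 * _)) => /le_trans; apply.
have : 2 * (K * a) / q <= `|2 * K / q| * e.
  rewrite (_ : 2 * (K * a) / q = 2 * K / q * a); last by ring.
  apply: le_trans (ler_wpM2r (ltW a0) (ler_norm _)) _.
  by rewrite ler_wpM2l// ltW.
move=> H3; rewrite mulrDl mul1r; apply: (lerD H1); exact: le_trans H2 H3.
Qed.

(** Linearity in [v] follows from that for [f], differentiated along [u], once [dD_comm] has
    exchanged the two derivatives. *)
Lemma dD_line_holomorphic f u : line_holomorphic f -> line_holomorphic (dD f u).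
Proof.
move=> nf; split=> [z|z v|z v].
- exact: dD_near_bounded.
- exact: dD_ddir.
- case: (nf) => _ _ lin; rewrite dD_comm//.
  under eq_bigr do rewrite dD_comm//.
  apply: (ddir_derive (d := \sum_j v 0 j * dD (dD f (delta_mx 0 j)) u z)).
  rewrite /ddir; under eq_fun do rewrite lin.
  apply: (@cder_sum R _ _ (fun j t => v 0 j * dD f (delta_mx 0 j) (z + t *: u)) _ 0) => j.
  by apply: cderZ; exact: dD_ddir.
Qed.

Lemma iter_dirder_line_holomorphic f u k : line_holomorphic f ->
  line_holomorphic (iter k (dirder u) f).
Proof.
move=> nf; elim: k => [|k IH]; first exact: nf.
by rewrite iterS (dirder_dD u IH); apply: (dD_line_holomorphic u IH).
Qed.

Lemma iter_dirder_line f u k w t : line_holomorphic f ->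
  cder (fun t => iter k (dirder u) f (w + t *: u)) t
    (iter k.+1 (dirder u) f (w + t *: u)).
Proof.
move=> nf; rewrite iterS; have nk := iter_dirder_line_holomorphic u k nf.
by rewrite (dirder_dD u nk); case: nk => _ d _; apply: ddir_line; exact: d.
Qed.

End DirectionalDerivative.

(** * Entire functions of one variable: Liouville's theorem and the cubic growth bound *)

Section OneVariable.
Variable R : realType.

(** An entire function carried together with all its derivatives, so that none has to be chosen. *)
Definition deriv_chain (g : nat -> R[i] -> R[i]) :=
  forall k z, cder (g k) z (g k.+1 z).

Implicit Types (g : nat -> R[i] -> R[i]) (z p s : R[i]) (l : nat).

Lemma liouville (h h' : R[i] -> R[i]) (M : R) : (forall z, cder h z (h' z)) ->
  (forall z, normc (h z) <= M) -> forall z, h' z = 0.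
Proof.
move=> dh hM z; apply: (normc_small_eq0 (K := 2 * M)) => e e0.
have := @cauchy_estimate R h h' dh z e^-1 M; rewrite invrK invr_gt0; apply => //.
Qed.

Lemma cauchy_estimate_iter g k n p (d M : R) : deriv_chain g -> 0 < d ->
  (forall z, normc (z - p) <= k%:R * d -> normc (g n z) <= M) ->
  normc (g (k + n)%N p) <= (2 / d) ^+ k * M.
Proof.
move=> dg d0; elim: k n M => [|k IH] n M hM.
  by rewrite expr0 mul1r; apply: hM; rewrite subrr normc0 mul0r.
rewrite addSnnS exprSr -mulrA; apply: IH => z hz.
rewrite mulrAC; apply: (cauchy_estimate (g := g n)) => // w hw; apply: hM.
by have := normc_distD z w p; rewrite -natr1 mulrDl mul1r; lra.
Qed.

(** Continuity gives local bounds, which bisection of the circumscribed square combines. *)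
Lemma bounded_disc (h h' : R[i] -> R[i]) p (r : R) : (forall z, cder h z (h' z)) ->
  exists M : R, forall z, normc (z - p) <= r -> normc (h z) <= M.
Proof.
move=> dh.
pose P (x y a b : R) := exists M : R, forall s t : R, x <= s <= x + a -> y <= t <= y + b ->
  normc (h (s +i* t)) <= M.
have [r0|r0] := leP 0 r; last first.
  by exists 0 => z hz; have := normc_ge0 (z - p); lra.
have r2 : 0 <= 2 * r by lra.
suff [M hM] : P (complex.Re p - r) (complex.Im p - r) (2 * r) (2 * r).
  exists M => -[s t] hz; apply: hM.
    have := le_trans (normc_Re _) hz; rewrite ReB /= => /ler_normlP[]; lra.
  have := le_trans (normc_Im _) hz; rewrite ImB /= => /ler_normlP[]; lra.
apply: (@rectangle_bisection R P) => //.
  move=> x y a b a0 b0 [M1 h1] [M2 h2] [M3 h3] [M4 h4].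
  exists (`|M1| + `|M2| + `|M3| + `|M4|) => s t hs ht.
  have := ler_norm M1; have := ler_norm M2; have := ler_norm M3; have := ler_norm M4.
  have := normr_ge0 M1; have := normr_ge0 M2; have := normr_ge0 M3; have := normr_ge0 M4.
  have [sa|sa] := leP s (x + a / 2); have [tb|tb] := leP t (y + b / 2).
  - by have := h1 s t; lra.
  - by have := h3 s t; lra.
  - by have := h2 s t; lra.
  - by have := h4 s t; lra.
move=> X Y; have [d d0 Hd] := cder_cont (dh (X +i* Y)) ltr01.
exists (d / 2); first by rewrite divr_gt0.
move=> x y a b hx hy ha hb; exists (normc (h (X +i* Y)) + 1) => s t hs ht.
have := Hd (s +i* t - X +i* Y); rewrite subrKC => H.
have := normcD (h (s +i* t) - h (X +i* Y)) (h (X +i* Y)); rewrite subrK.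
have : normc (h (s +i* t) - h (X +i* Y)) <= 1; last by lra.
apply: H; apply: le_lt_trans (normc_ReIm _) _ => /=.
have : `|s - X| < d / 2 by apply/ltr_normlP; split; lra.
have : `|t - Y| < d / 2 by apply/ltr_normlP; split; lra.
lra.
Qed.

(* Let [S] be the supremum of [|g 0 z| * (1 - |z - p|) ^ l] over the unit disc. At
   an almost maximal point the Cauchy estimates bound [g l] linearly in [S], so the
   hypothesis yields [S ^ 3 <= 8 (N ^ 3 + D * S)]. *)
Lemma local_bound (kappa : R[i]) l : (0 < l)%N -> exists2 C : R, 0 < C &
  forall g p (N : R), deriv_chain g -> 1 <= N ->
    (forall z, normc (z - p) <= 1 -> normc (g 0%N z ^+ 3 + kappa * g l z) <= N ^+ 3) ->
    normc (g 0%N p) <= C * N.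
Proof.
move=> l0; pose D := normc kappa * (8 * l%:R) ^+ l.
have lR0 : 0 < l%:R :> R by rewrite ltr0n.
have D0 : 0 <= D by rewrite mulr_ge0 ?normc_ge0// exprn_ge0// mulr_ge0.
exists (4 + 16 * D); first by lra.
move=> g p N dg N1 hN.
have [M hM] := bounded_disc p 1 (dg 0%N).
pose wt z := (1 - normc (z - p)) ^+ l.
pose A := [set x : R | exists z, normc (z - p) <= 1 /\ x = normc (g 0%N z) * wt z]%classic.
have wt0 z : normc (z - p) <= 1 -> 0 <= wt z by move=> ?; apply: exprn_ge0; lra.
have wt1 z : normc (z - p) <= 1 -> wt z <= 1.
  by move=> ?; have := normc_ge0 (z - p) => ?; apply: exprn_ile1; lra.
have ubA : ubound A M.
  move=> _ [z [hz ->]]; apply: le_trans (hM z hz).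
  by rewrite ler_piMr ?normc_ge0// wt1.
have Ap : A (normc (g 0%N p)).
  by exists p; rewrite /wt subrr normc0 subr0 expr1n mulr1; split => //; exact: ler01.
pose S := sup A.
have AS x : A x -> x <= S by move=> Ax; apply: ub_le_sup => //; exists M.
apply: le_trans (AS _ Ap) _.
have [S0|S0] := leP S 0.
  by apply: le_trans S0 _; rewrite mulr_ge0//; lra.
have [x [z [hz ->]] hx] : exists2 x, A x & S / 2 < x.
  by apply: sup_gt; [exists (normc (g 0%N p))|rewrite -/S; lra].
pose d := 1 - normc (z - p).
have d1 : d <= 1 by have := normc_ge0 (z - p); rewrite /d; lra.
have d0 : 0 < d.
  rewrite lt_def /d subr_ge0 hz andbT; apply/eqP => dz.
  by move: hx; rewrite /wt dz expr0n gtn_eqF// mulr0; lra.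
have gw w : normc (w - z) <= d / 2 -> normc (g 0%N w) <= S * (2 / d) ^+ l.
  move=> hw; have hwp : d / 2 <= 1 - normc (w - p).
    by have := normc_distD z w p; rewrite /d in hw *; lra.
  have hw1 : normc (w - p) <= 1 by lra.
  have : normc (g 0%N w) * wt w <= S by apply: AS; exists w.
  have : (d / 2) ^+ l <= wt w by rewrite lerXn2r ?nnegrE//; lra.
  rewrite -[2 / d]invf_div exprVn ler_pdivlMr ?exprn_gt0 ?divr_gt0// => h1 h2.
  by apply: le_trans h2; rewrite ler_wpM2l ?normc_ge0.
(* The [l] Cauchy discs of radius [d / (2 * l)] stay within distance [d / 2] of [z], where [gw]
   applies. *)
have gl : normc (g l z) <= (4 * l%:R / d) ^+ l * (S * (2 / d) ^+ l).
  have q0 : 0 < d / (2 * l%:R) by rewrite divr_gt0// mulr_gt0.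
  have := cauchy_estimate_iter (n := 0) (k := l) (p := z) (M := S * (2 / d) ^+ l) dg q0.
  rewrite addn0 (_ : 2 / (d / (2 * l%:R)) = 4 * l%:R / d); last first.
    by field; rewrite !gt_eqF.
  apply => w hw; apply: gw; apply: le_trans hw _.
  by rewrite le_eqVlt; apply/orP; left; apply/eqP; field; rewrite !gt_eqF.
have dl0 : 0 < d ^+ l by rewrite exprn_gt0.
have dl1 : d ^+ l <= 1 by rewrite exprn_ile1// ltW.
have main : normc (g 0%N z) ^+ 3 <= N ^+ 3 + D * S / (d ^+ l) ^+ 2.
  have := normcB (g 0%N z ^+ 3 + kappa * g l z) (kappa * g l z).
  rewrite addrK normcX normcM => /le_trans; apply; apply: lerD; first exact: hN.
  have -> : D * S / (d ^+ l) ^+ 2 =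
      normc kappa * ((4 * l%:R / d) ^+ l * (S * (2 / d) ^+ l)).
    rewrite /D (_ : 8 * l%:R = 4 * l%:R * 2); last by ring.
    by rewrite !exprMn !exprVn; field; rewrite gt_eqF.
  by rewrite ler_wpM2l ?normc_ge0.
have {}hx : S / 2 < normc (g 0%N z) * d ^+ l by [].
set y := normc (g 0%N z) in main hx; set q := d ^+ l in main hx dl0 dl1.
have y0 : 0 <= y by exact: normc_ge0.
(* Multiplication by [q ^ 3] absorbs the denominator [q ^ 2] of the derivative term, since [q <= 1]:
   here the cube dominates. *)
have m2 : (y * q) ^+ 3 <= N ^+ 3 + D * S.
  rewrite exprMn; have q3 : 0 < q ^+ 3 by rewrite exprn_gt0.
  apply: le_trans (ler_wpM2r (ltW q3) main) _; rewrite mulrDl; apply: lerD.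
    by rewrite ler_piMr ?exprn_ge0 ?exprn_ile1//; lra.
  rewrite (_ : D * S / q ^+ 2 * q ^+ 3 = D * S * q); last by field; rewrite gt_eqF.
  by rewrite ler_piMr// mulr_ge0// ltW.
have m3 : (S / 2) ^+ 3 <= N ^+ 3 + D * S.
  by apply: le_trans m2; rewrite lerXn2r// ?nnegrE ?mulr_ge0//; lra.
(* Otherwise [N ^ 3 <= S ^ 3 / 64] and [D * S < S ^ 3 / 16], whose sum is below [S ^ 3 / 8]. *)
rewrite leNgt; apply/negP => hS.
have C4 : 4 + 16 * D <= S.
  by apply: le_trans (ltW hS); rewrite ler_peMr//; lra.
have N4 : 4 * N < S.
  apply: le_lt_trans hS; rewrite ler_wpM2r//; lra.
have b1 : N ^+ 3 <= (S / 4) ^+ 3 by rewrite lerXn2r// ?nnegrE; lra.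
have b2 : 16 * D * S < S ^+ 3.
  rewrite (exprSr S 2) ltr_pM2r//.
  have : (4 + 16 * D) ^+ 2 <= S ^+ 2 by rewrite lerXn2r// ?nnegrE; lra.
  by have := mulr_ge0 D0 D0; nra.
have S3 : 0 < S ^+ 3 by rewrite exprn_gt0.
have e1 : (S / 2) ^+ 3 = S ^+ 3 / 8 by field.
have e2 : (S / 4) ^+ 3 = S ^+ 3 / 64 by field.
by rewrite e1 in m3; rewrite e2 in b1; lra.
Qed.

Lemma cubic_coef_eq0 (c0 c1 c2 c3 : R[i]) :
  (forall n, c3 * n.+1%:R ^+ 3 + c2 * n.+1%:R ^+ 2 + c1 * n.+1%:R + c0 = 0) ->
  [/\ c0 = 0, c1 = 0, c2 = 0 & c3 = 0].
Proof.
move=> H; pose p (y : R[i]) := c3 * y ^+ 3 + c2 * y ^+ 2 + c1 * y + c0.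
have p1 : p 1 = 0 := H 0%N.
have p2 : p 2 = 0 := H 1%N.
have p3 : p 3 = 0 := H 2%N.
have p4 : p 4 = 0 := H 3%N.
have k0 (x : R[i]) n : n.+1%:R * x = 0 -> x = 0.
  by move/eqP; rewrite mulf_eq0 pnatr_eq0 /= => /eqP.
have e3 : c3 = 0.
  (* The third difference of [p] is [6 * c3]; as [k0] concerns [n.+1], the argument is 5. *)
  apply: (k0 _ 5); transitivity (p 4 - 3 * p 3 + 3 * p 2 - p 1); first by rewrite /p; ring.
  by rewrite p1 p2 p3 p4; ring.
have e2 : c2 = 0.
  apply: (k0 _ 1); transitivity (p 3 - 2 * p 2 + p 1); first by rewrite /p e3; ring.
  by rewrite p1 p2 p3; ring.
have e1 : c1 = 0.
  transitivity (p 2 - p 1); first by rewrite /p e3 e2; ring.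
  by rewrite p1 p2; ring.
by split=> //; rewrite -[RHS]p1 /p e3 e2 e1; ring.
Qed.

End OneVariable.

(** * The one-variable equation with exponents [3 * s] and [- 3 * s] *)

Section ExponentialEquation.
Variable R : realType.
Implicit Types (g : nat -> R[i] -> R[i]) (s z : R[i]) (l : nat).

Definition exp_equation g (kappa A B : R[i]) l := forall s,
  g 0%N s ^+ 3 + kappa * g l s = A * cexp s ^+ 3 + B * cexp (- s) ^+ 3.

Lemma Re_dist z s (r : R) : normc (z - s) <= r -> `|complex.Re z - complex.Re s| <= r.
Proof. by rewrite -ReB; apply: le_trans (normc_Re _). Qed.

Lemma ReN z : complex.Re (- z) = - complex.Re z.
Proof. by case: z. Qed.

Lemma normc_rhs_le (A B : R[i]) s : normc (A * cexp s ^+ 3 + B * cexp (- s) ^+ 3) <=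
  (normc A + normc B) * expR `|complex.Re s| ^+ 3.
Proof.
apply: le_trans (normcD _ _) _; rewrite mulrDl; apply: lerD;
  rewrite normcM ler_wpM2l ?normc_ge0// normcX normc_cexp;
  rewrite lerXn2r ?nnegrE ?expR_ge0// ler_expR; first exact: ler_norm.
by rewrite ReN -normrN ler_norm.
Qed.

Lemma solution_growth g (kappa A B : R[i]) l : (0 < l)%N -> deriv_chain g ->
  exp_equation g kappa A B l -> exists2 C : R, 0 < C &
  forall s, normc (g 0%N s) <= C * expR `|complex.Re s|.
Proof.
move=> l0 dg eqg; have [C C0 HC] := local_bound kappa l0.
(* On the unit disc at [s] the right-hand side is at most the cube of [a * expR (x + 1)], because
   [a <= a ^ 3]. *)
pose a := 1 + normc A + normc B.
have a1 : 1 <= a by have := normc_ge0 A; have := normc_ge0 B; rewrite /a; lra.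
exists (C * (a * expR 1)); first by rewrite !mulr_gt0 ?expR_gt0//; lra.
move=> s; set x := `|complex.Re s|.
have x0 : 0 <= x by exact: normr_ge0.
have ex : 1 <= expR (x + 1) by rewrite -[leLHS]expR0 ler_expR; lra.
have := HC g s (a * expR (x + 1)) dg; rewrite -!mulrA -expRD (addrC 1); apply.
  exact: mulr_ege1.
move=> z zs; rewrite eqg; apply: le_trans (normc_rhs_le _ _ _) _.
rewrite exprMn; apply: ler_pM; rewrite ?exprn_ge0 ?expR_ge0 ?addr_ge0 ?normc_ge0//.
  have : a ^+ 1 <= a ^+ 3 by apply: ler_weXn2l.
  by rewrite expr1 /a; lra.
rewrite lerXn2r ?nnegrE ?expR_ge0// ler_expR.
have := Re_dist zs; have := ler_normD (complex.Re z - complex.Re s) (complex.Re s).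
by rewrite subrK -/x; lra.
Qed.

Lemma deriv_growth g (C : R) k : deriv_chain g ->
  (forall s, normc (g 0%N s) <= C * expR `|complex.Re s|) ->
  exists2 K : R, 0 <= K & forall s, normc (g k s) <= K * expR `|complex.Re s|.
Proof.
move=> dg hC; have C0 : 0 <= C.
  have := hC 0; rewrite normr0 expR0 mulr1; apply: le_trans; exact: normc_ge0.
exists (2 ^+ k * (C * expR k%:R)); first by rewrite !mulr_ge0 ?exprn_ge0 ?expR_ge0.
move=> s.
have := @cauchy_estimate_iter R g k 0 s 1 (C * expR (k%:R + `|complex.Re s|)) dg ltr01.
rewrite addn0 divr1 mulr1 expRD !mulrA; apply => z zs.
apply: le_trans (hC z) _; rewrite -!mulrA ler_wpM2l// -expRD ler_expR.
have := Re_dist zs; have := ler_normD (complex.Re z - complex.Re s) (complex.Re s).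
by rewrite subrK; lra.
Qed.

Lemma right_half_plane g (kappa A B : R[i]) l : (0 < l)%N -> A != 0 -> deriv_chain g ->
  exp_equation g kappa A B l -> exists X K : R, forall s, X <= complex.Re s ->
    normc (g 2%N s - g 0%N s) <= K * expR (- complex.Re s).
Proof.
move=> l0 A0 dg eqg; have [C C0 hC] := solution_growth l0 dg eqg.
have [Cl Cl0 hCl] := deriv_growth l dg hC.
have [Cm Cm0 hCm] := deriv_growth l.+1 dg hC.
have An0 : 0 < normc A by rewrite normc_gt0.
have B0 := normc_ge0 B; have k0 := normc_ge0 kappa.
have deq s : 3 * g 0%N s ^+ 2 * g 1%N s + kappa * g l.+1 s =
    3 * (A * cexp s ^+ 3 - B * cexp (- s) ^+ 3).
  apply: (@cder_unique R (fun s => g 0%N s ^+ 3 + kappa * g l s) s).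
    have -> : 3 * g 0%N s ^+ 2 * g 1%N s = (g 1%N s * g 0%N s + g 0%N s * g 1%N s) * g 0%N s
       + g 0%N s * g 0%N s * g 1%N s by ring.
    apply: cderD; last exact/cderZ/dg.
    have := cderM (cderM (dg 0%N s) (dg 0%N s)) (dg 0%N s).
    by apply: littleo_ext => h; ring.
  rewrite (_ : (fun _ => _) = (fun s => A * cexp (3 * s) + B * cexp (-3 * s))); last first.
    apply/funext => t; rewrite eqg -!cexpM_nat; congr (_ + _ * cexp _); ring.
  have dexp (c : R[i]) : cder (fun t => cexp (c * t)) s (c * cexp (c * s)).
    have := @cder_comp R (fun t => 0 + c * t) (@cexp R) s c (cexp (c * s)) (cder_affine 0 c s).
    by under eq_fun do rewrite add0r; rewrite add0r; apply; exact: cder_cexp.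
  have := cderD (cderZ A (dexp 3)) (cderZ B (dexp (-3))).
  rewrite -!cexpM_nat (_ : 3%:R * - s = -3 * s); last by ring.
  by apply: littleo_ext => h; ring.
pose K1 := 2 * normc B + normc kappa * (Cm + Cl).
pose K2 := normc B + normc kappa * Cl.
have K10 : 0 <= K1 by rewrite addr_ge0 ?mulr_ge0 ?addr_ge0.
have K20 : 0 <= K2 by rewrite addr_ge0 ?mulr_ge0.
pose K3 := K1 * (2 * C / normc A).
have K30 : 0 <= K3 by rewrite !mulr_ge0// ?invr_ge0 ltW.
(* Beyond this abscissa the lower-order terms [K2 * y] are at most half of [normc A * y ^ 3]. *)
pose X := ln (1 + 2 * K2 / normc A).
have Xarg : 1 <= 1 + 2 * K2 / normc A by rewrite lerDl divr_ge0 ?mulr_ge0// ltW.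
have X0 : 0 <= X by rewrite ln_ge0.
have q1 s : X <= complex.Re s ->
    normc (g 1%N s - g 0%N s) <= K3 * expR (- complex.Re s).
  move=> Xs; have x0 : 0 <= complex.Re s by lra.
  have xE : `|complex.Re s| = complex.Re s by rewrite ger0_norm.
  have := hC s; have := hCl s; have := hCm s; rewrite !xE => bm bl bC.
  set y := expR (complex.Re s) in bm bl bC *.
  have yX : 1 + 2 * K2 / normc A <= y by rewrite -[leLHS]lnK ?posrE ?ler_expR//; lra.
  have y1 : 1 <= y by lra.
  have nB : normc (B * cexp (- s) ^+ 3) <= normc B * y.
    rewrite normcM ler_wpM2l// normcX normc_cexp.
    have h1 : expR (complex.Re (- s)) <= 1 by rewrite ReN -expR0 ler_expR; lra.
    apply: le_trans y1; rewrite exprn_ile1// expR_ge0.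
  have nA : normc (A * cexp s ^+ 3) = normc A * y ^+ 3.
    by rewrite normcM normcX normc_cexp.
  (* Subtracting the equation from a third of its derivative cancels the terms in [A]. *)
  have e1 : normc (g 0%N s ^+ 2 * (g 1%N s - g 0%N s)) <= K1 * y.
    have -> : g 0%N s ^+ 2 * (g 1%N s - g 0%N s) =
        kappa * g l s - kappa * g l.+1 s / 3 - 2 * (B * cexp (- s) ^+ 3).
      have E1 := deq s; have E2 := eqg s.
      have -> : kappa * g l.+1 s = 3 * (A * cexp s ^+ 3 - B * cexp (- s) ^+ 3)
         - 3 * g 0%N s ^+ 2 * g 1%N s by rewrite -E1; ring.
      have -> : kappa * g l s = A * cexp s ^+ 3 + B * cexp (- s) ^+ 3 - g 0%N s ^+ 3.
        by rewrite -E2; ring.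
      by field.
    apply: le_trans (normcB _ _) _; apply: le_trans (lerD (normcB _ _) (lexx _)) _.
    have n3 : normc ((3 : R[i])^-1)%R = (3^-1)%R.
      by rewrite normcV (_ : 3 = 3%:R%:C) ?normc_real ?normr_nat// rmorph_nat.
    have n2 : normc (2 : R[i]) = 2.
      by rewrite (_ : 2 = 2%:R%:C) ?normc_real ?normr_nat// rmorph_nat.
    rewrite normcM (normcM _ (3^-1)%R) n3 (normcM kappa) (normcM 2) n2.
    have := ler_wpM2l k0 bm; have := ler_wpM2l k0 bl.
    have : 0 <= normc kappa * normc (g l.+1 s) by rewrite mulr_ge0 ?normc_ge0.
    rewrite /K1; lra.
  have e2 : normc A / 2 * y ^+ 3 <= normc (g 0%N s) ^+ 3.
    have h1 : normc A * y ^+ 3 <= normc (g 0%N s) ^+ 3 + K2 * y.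
      rewrite -nA -normcX.
      have -> : A * cexp s ^+ 3 = g 0%N s ^+ 3 + (kappa * g l s - B * cexp (- s) ^+ 3).
        by rewrite addrA eqg addrK.
      apply: le_trans (normcD _ _) _; rewrite lerD2l.
      apply: le_trans (normcB _ _) _; rewrite normcM.
      by have := ler_wpM2l k0 bl; rewrite /K2; lra.
    have h2 : K2 <= normc A / 2 * y.
      have : 2 * K2 / normc A <= y by lra.
      by rewrite ler_pdivrMr//; lra.
    have h3 : K2 * y <= normc A / 2 * y ^+ 3.
      have : K2 * y <= normc A / 2 * y * y by rewrite ler_wpM2r//; lra.
      have : normc A / 2 * y * y <= normc A / 2 * y * y * y.
        by rewrite ler_peMr// !mulr_ge0//; lra.
      rewrite !exprS expr0; lra.
    lra.
  (* One factor of the cube is removed using the upper bound [C * y] for the modulus of [g]. *)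
  have e3 : normc A / (2 * C) * y ^+ 2 <= normc (g 0%N s) ^+ 2.
    have y0 : 0 < C * y by rewrite mulr_gt0//; lra.
    rewrite -(ler_pM2r y0).
    have -> : normc A / (2 * C) * y ^+ 2 * (C * y) = normc A / 2 * y ^+ 3.
      by field; rewrite gt_eqF.
    apply: le_trans e2 _; rewrite exprSr ler_wpM2l// exprn_ge0// normc_ge0//.
  rewrite expRN -/y.
  have y0 : 0 < y by lra.
  have Y0 : 0 < normc A / (2 * C) * y ^+ 2.
    by rewrite mulr_gt0 ?divr_gt0 ?exprn_gt0 ?mulr_gt0.
  rewrite -(ler_pM2l Y0).
  apply: le_trans (ler_wpM2r (normc_ge0 _) e3) _.
  rewrite -normcX -normcM; apply: le_trans e1 _.
  rewrite le_eqVlt; apply/orP; left; apply/eqP; rewrite /K3; field.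
  by rewrite !gt_eqF.
(* The margin 1 leaves room for a unit disc, on which [expR (- Re)] grows by at most the factor
   [expR 1]. *)
exists (X + 1), (K3 * (1 + 2 * expR 1)) => s Xs.
have dq z : cder (fun z => g 1%N z - g 0%N z) z (g 2%N z - g 1%N z).
  exact: cderB (dg 1%N z) (dg 0%N z).
have q2 : normc (g 2%N s - g 1%N s) <= 2 * (K3 * (expR 1 * expR (- complex.Re s))) / 1.
  apply: (cauchy_estimate dq) => // z zs.
  have /ler_normlP[h1 h2] := Re_dist zs.
  apply: le_trans (q1 z _) _; first by lra.
  by rewrite ler_wpM2l// -expRD ler_expR; lra.
have Xs' : X <= complex.Re s by lra.
have := normcD (g 2%N s - g 1%N s) (g 1%N s - g 0%N s).
by rewrite addrA subrK; have := q1 s Xs'; lra.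
Qed.

(** The reflection [s -> - s] exchanges [A] and [B] and carries the right half-plane estimate to the
    left; [kappa] acquires the sign [(-1) ^ l]. *)
Lemma cder_reflect g : deriv_chain g -> deriv_chain (fun k s => (-1) ^+ k * g k (- s)).
Proof.
move=> dg k z; rewrite exprSr -mulrA; apply: cderZ.
have := @cder_comp R (fun s => 0 + (-1) * s) (g k) z (-1) (g k.+1 (- z)) (cder_affine _ _ _).
by under eq_fun do rewrite add0r mulN1r; rewrite add0r mulN1r; apply.
Qed.

Lemma second_derivative_eq g (kappa A B : R[i]) l : (0 < l)%N -> A != 0 -> B != 0 ->
  deriv_chain g -> exp_equation g kappa A B l -> forall s, g 2%N s = g 0%N s.
Proof.
move=> l0 A0 B0 dg eqg.
have [X1 [K1 h1]] := right_half_plane l0 A0 dg eqg.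
have [|X2 [K2 h2]] := @right_half_plane (fun k s => (-1) ^+ k * g k (- s))
    (kappa * (-1) ^+ l) B A l l0 B0 (cder_reflect dg).
  have sgn : (-1) ^+ l * (-1) ^+ l = 1 :> R[i] by rewrite -expr2 sqrr_sign.
  move=> s; rewrite expr0 mul1r (_ : kappa * (-1) ^+ l * ((-1) ^+ l * g l (- s)) =
    (-1) ^+ l * (-1) ^+ l * kappa * g l (- s)); last by ring.
  by rewrite sgn mul1r eqg opprK addrC.
have {}h2 s : X2 <= - complex.Re s -> normc (g 2%N s - g 0%N s) <= K2 * expR (complex.Re s).
  have := h2 (- s); rewrite ReN !opprK expr0 sqrrN expr1n !mul1r; exact.
have [C C0 hC] := solution_growth l0 dg eqg.
have [D D0 hD] := deriv_growth 2 dg hC.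
pose X := `|X1| + `|X2|.
have [X1X X2X] : X1 <= X /\ X2 <= X.
  have := ler_norm X1; have := ler_norm X2; have := normr_ge0 X1; have := normr_ge0 X2.
  by rewrite /X; split; lra.
have X0 : 0 <= X by rewrite addr_ge0.
have dh z : cder (fun z => g 2%N z - g 0%N z) z (g 3%N z - g 1%N z).
  exact: cderB (dg 2%N z) (dg 0%N z).
(* The two half-planes are covered by the exponential estimates, the strip between them by the
   growth of [g]. *)
have bound s : normc (g 2%N s - g 0%N s) <= `|K1| + `|K2| + (D + C) * expR X.
  have N1 := normr_ge0 K1; have N2 := normr_ge0 K2.
  have N3 : 0 <= (D + C) * expR X by rewrite mulr_ge0 ?expR_ge0//; lra.
  have e1 (K x : R) : x <= 0 -> K * expR x <= `|K|.
    move=> x0; apply: le_trans (ler_wpM2r (expR_ge0 _) (ler_norm K)) _.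
    by rewrite ler_piMr// -expR0 ler_expR.
  have [p1|p1] := leP X (complex.Re s).
    have := e1 K1 (- complex.Re s); have := h1 s; lra.
  have [p2|p2] := leP (complex.Re s) (- X).
    have := e1 K2 (complex.Re s); have := h2 s; lra.
  have sX : `|complex.Re s| <= X by apply/ler_normlP; split; lra.
  apply: le_trans (normcB _ _) _.
  have := hD s; have := hC s.
  have := ler_wpM2l D0 (_ : expR `|complex.Re s| <= expR X).
  have := ler_wpM2l (ltW C0) (_ : expR `|complex.Re s| <= expR X).
  rewrite ler_expR; lra.
have h0 := liouville dh bound.
have cst z w := @cder0_const R (fun z => g 2%N z - g 0%N z)
  (fun z => eq_rect _ (cder _ z) (dh z) _ (h0 z)) z w.
move=> s; apply/eqP; rewrite -subr_eq0; apply/eqP.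
apply: (normc_small_eq0 (K := `|K1|)) => e e0.
(* The constant is evaluated far to the right, where [expR (- x) <= e]. *)
pose x := Num.max X (- ln e).
rewrite (cst s x%:C).
have Xx : X <= x by rewrite /x le_max lexx.
have ex : expR (- x) <= e.
  by rewrite -[leRHS]lnK ?posrE// ler_expR lerNl /x le_max lexx orbT.
apply: le_trans (h1 _ _) _ => /=; first lra.
apply: le_trans (ler_wpM2r (expR_ge0 _) (ler_norm K1)) _.
by rewrite ler_wpM2l.
Qed.

(** The product of [P] with [cexp (- c * z)] has derivative zero. *)
Lemma cexp_multiple (P : R[i] -> R[i]) (c : R[i]) : (forall z, cder P z (c * P z)) ->
  forall s, P s = P 0 * cexp (c * s).
Proof.
move=> dP s.
have dE z : cder (fun z => P z * cexp (- c * z)) z 0.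
  have dexp : cder (fun t => cexp (- c * t)) z (- c * cexp (- c * z)).
    have := @cder_comp R (fun t => 0 + - c * t) (@cexp R) z (- c) (cexp (- c * z))
      (cder_affine 0 (- c) z).
    by under eq_fun do rewrite add0r; rewrite add0r; apply; exact: cder_cexp.
  have := cderM (dP z) dexp.
  by rewrite (_ : _ + _ = 0)//; ring.
have := cder0_const dE s 0; rewrite mulr0 cexp0 mulr1 => <-.
by rewrite -mulrA -cexpD mulNr addNr cexp0 mulr1.
Qed.

Lemma no_solution g (kappa A B : R[i]) l : odd l -> A != 0 -> B != 0 ->
  deriv_chain g -> ~ exp_equation g kappa A B l.
Proof.
move=> ol A0 B0 dg eqg.
have l0 : (0 < l)%N by case: l ol {eqg}.
have g2 := second_derivative_eq l0 A0 B0 dg eqg.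
have gS k s : g k.+2 s = g k s.
  elim: k s => [|k IH] s; first exact: g2.
  by apply: (@cder_unique R (g k.+2) s) => //; rewrite (funext IH).
have glE : g l = g 1%N.
  rewrite -(odd_double_half l) ol add1n; elim: l./2 => [//|k IH].
  by rewrite doubleS; apply/funext => s; rewrite gS IH.
pose a := (g 0%N 0 + g 1%N 0) / 2; pose b := (g 0%N 0 - g 1%N 0) / 2.
have P s : g 0%N s + g 1%N s = 2 * a * cexp s.
  rewrite -[s in RHS]mul1r (_ : 2 * a = g 0%N 0 + g 1%N 0); last by rewrite /a; field.
  apply: (@cexp_multiple (fun s => g 0%N s + g 1%N s)) => z.
  by rewrite mul1r addrC -{1}g2; exact: cderD (dg 0%N z) (dg 1%N z).
have Q s : g 0%N s - g 1%N s = 2 * b * cexp (- s).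
  rewrite -[- s]mulN1r (_ : 2 * b = g 0%N 0 - g 1%N 0); last by rewrite /b; field.
  apply: (@cexp_multiple (fun s => g 0%N s - g 1%N s)) => z.
  by rewrite mulN1r opprB -{1}g2; exact: cderB (dg 0%N z) (dg 1%N z).
have g0E s : g 0%N s = a * cexp s + b * cexp (- s).
  have -> : g 0%N s = ((g 0%N s + g 1%N s) + (g 0%N s - g 1%N s)) / 2 by field.
  by rewrite P Q; field.
have g1E s : g 1%N s = a * cexp s - b * cexp (- s).
  have -> : g 1%N s = ((g 0%N s + g 1%N s) - (g 0%N s - g 1%N s)) / 2 by field.
  by rewrite P Q; field.
clearbody a b.
have [e0 e1 e2 e3] : [/\ b ^+ 3 - B = 0, 3 * a * b ^+ 2 - kappa * b = 0,
    3 * a ^+ 2 * b + kappa * a = 0 & a ^+ 3 - A = 0].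
  (* At [s = ln n.+1 / 2] one has [y ^ 2 = n.+1], and the equation multiplied by [y ^ 3] is a cubic
     polynomial identity in [y ^ 2]. *)
  apply: cubic_coef_eq0 => n.
  pose y := cexp ((ln n.+1%:R / 2)%:C : R[i]).
  have y2 : y ^+ 2 = n.+1%:R.
    rewrite -cexpM_nat (_ : 2%:R * _ = (ln n.+1%:R)%:C); last first.
      by rewrite -[2%:R](rmorph_nat (real_complex R)) -rmorphM mulrC divfK.
    rewrite /cexp /= cos0 sin0 mulr0 mulr1 lnK ?posrE ?ltr0n//.
    by rewrite -[RHS](rmorph_nat (real_complex R)).
  have := eqg (ln n.+1%:R / 2)%:C; rewrite glE g0E g1E cexpN -/y => E.
  have y0 : y != 0 by exact: cexp_neq0.
  have := congr1 (fun t => t * y ^+ 3) E => {}E.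
  rewrite -y2; apply/eqP; rewrite -subr_eq0 subr0; apply/eqP.
  have : ((a * y + b / y) ^+ 3 + kappa * (a * y - b / y)) * y ^+ 3 -
      (A * y ^+ 3 + B * y^-1 ^+ 3) * y ^+ 3 = 0 by rewrite E subrr.
  by move=> <-; field.
have a0 : a != 0.
  apply: contra_neq A0 => a0; move: e3; rewrite a0 expr0n sub0r => /eqP.
  by rewrite oppr_eq0 => /eqP.
have b0 : b != 0.
  apply: contra_neq B0 => b0; move: e0; rewrite b0 expr0n sub0r => /eqP.
  by rewrite oppr_eq0 => /eqP.
have : 6 * (a * b) * (a * b) = 0.
  (* This combination of [e2] and [e1] eliminates [kappa]. *)
  transitivity ((3 * a ^+ 2 * b + kappa * a) * b + a * (3 * a * b ^+ 2 - kappa * b)); first by ring.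
  by rewrite e1 e2 mul0r mulr0 addr0.
by move/eqP; rewrite !mulf_eq0 (negPf a0) (negPf b0) pnatr_eq0.
Qed.

End ExponentialEquation.

(** * Restriction of the equation to complex lines *)

Section PairingLines.
Variables (R : realType) (m : nat).
Implicit Types (lam u w : 'rV[R[i]]_m).

Lemma pairing_line lam u w (t : R[i]) :
  pairing lam (w + t *: u) = pairing lam w + t * pairing lam u.
Proof.
rewrite /pairing mulr_sumr -big_split /=; apply: eq_bigr => k _.
by rewrite !mxE mulrDr mulrCA.
Qed.

Lemma pairing_scale lam u (t : R[i]) : pairing lam (t *: u) = t * pairing lam u.
Proof.
by rewrite /pairing mulr_sumr; apply: eq_bigr => k _; rewrite !mxE mulrCA.
Qed.

Lemma pairing_delta lam (k : 'I_m) : pairing lam (delta_mx 0 k) = lam 0 k.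
Proof.
rewrite /pairing (bigD1 k)//= mxE !eqxx mulr1 big1 ?addr0// => j jk.
by rewrite mxE eqxx (negPf jk) mulr0.
Qed.

(* The line is reparametrised so that the exponents become [3 s] and [- 3 s]. *)
Lemma no_solution_on_line (f : 'rV[R[i]]_m -> R[i]) lam u (kappa p1 p2 : R[i]) l :
  line_holomorphic f -> odd l -> p1 != 0 -> p2 != 0 -> pairing lam u != 0 ->
  ~ forall z, f z ^+ 3 + kappa * iter l (dirder u) f z =
      p1 * cexp (pairing lam z) + p2 * cexp (- pairing lam z).
Proof.
move=> nf ol p10 p20 c0 eqf; set c := pairing lam u in c0.
(* The factor [(3 / c) ^ k] comes from the chain rule; it is compensated by [(c / 3) ^ l] in the new
   [kappa]. *)
pose g k s := (3 / c) ^+ k * iter k (dirder u) f ((3 / c * s) *: u).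
have dg : deriv_chain g.
  move=> k z; rewrite /g exprSr -mulrA; apply: cderZ.
  have := iter_dirder_line u k 0 (3 / c * z) nf; rewrite add0r.
  under eq_fun do rewrite add0r.
  have := @cder_comp R (fun s => 0 + 3 / c * s) (fun t => iter k (dirder u) f (t *: u)) z
    (3 / c) _ (cder_affine _ _ _).
  rewrite add0r => H /H; by under eq_fun do rewrite add0r.

apply: (no_solution (kappa := kappa * (c / 3) ^+ l) ol p10 p20 dg) => s.
rewrite /g expr0 mul1r (_ : kappa * (c / 3) ^+ l * ((3 / c) ^+ l * _) =
    kappa * iter l (dirder u) f ((3 / c * s) *: u)); last first.
  rewrite -mulrA [(c / 3) ^+ l * _]mulrA -exprMn (_ : c / 3 * (3 / c) = 1) ?expr1n ?mul1r//.
  by field; rewrite ?pnatr_eq0 ?c0.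
rewrite eqf pairing_scale -/c -!cexpM_nat.
have -> : 3 / c * s * c = 3%:R * s by field.
by rewrite mulrN.
Qed.

(** On each line in direction [u] the right-hand side is a constant [K], so [local_bound] is uniform
    in [t] and Liouville's theorem applies. *)
Lemma dirder_eq0_of_constant_rhs (f : 'rV[R[i]]_m -> R[i]) lam u (p1 p2 : R[i]) l :
  line_holomorphic f -> (0 < l)%N -> pairing lam u = 0 ->
  (forall z, f z ^+ 3 + iter l (dirder u) f z =
      p1 * cexp (pairing lam z) + p2 * cexp (- pairing lam z)) ->
  forall z, dirder u f z = 0.
Proof.
move=> nf l0 c0 eqf z.
pose g k t := iter k (dirder u) f (z + t *: u).
have dg : deriv_chain g by move=> k t; exact: iter_dirder_line.
have [C C0 HC] := local_bound (1 : R[i]) l0.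
pose K := p1 * cexp (pairing lam z) + p2 * cexp (- pairing lam z).
pose N := 1 + normc K.
have N1 : 1 <= N by rewrite lerDl normc_ge0.
have bnd t : normc (g 0%N t) <= C * N.
  apply: (HC g t N dg N1) => s _; rewrite mul1r /g /= eqf pairing_line c0 mulr0 addr0 -/K.
  have : N ^+ 1 <= N ^+ 3 by apply: ler_weXn2l.
  by rewrite expr1 {1}/N; lra.
have := liouville (dg 0%N) bnd 0.
by rewrite /g /= scale0r addr0.
Qed.

Lemma iter_dirder_eq0 (f : 'rV[R[i]]_m -> R[i]) u l : line_holomorphic f -> (0 < l)%N ->
  (forall z, dirder u f z = 0) -> forall z, iter l (dirder u) f z = 0.
Proof.
move=> nf + d0; case: l => [//|l] _; elim: l => [|l IH] z; first exact: d0.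
have := iter_dirder_line u l.+1 z 0 nf; rewrite scale0r addr0 => H.
apply: (cder_unique H); apply: littleo_ext (cder_cst 0 0) => h; by rewrite !IH.
Qed.

End PairingLines.

Theorem theorem2p5 (R : realType) (m : nat) (hm : (1 <= m)%N)
    (u lam : 'rV[R[i]]_m) (p1 p2 : R[i]) (l : nat)
    (hu : u != 0) (hp1 : p1 != 0) (hp2 : p2 != 0)
    (hlam : forall k : 'I_m, lam 0 k != 0)
    (hl1 : (1 <= l)%N) (hl : odd l) :
  ~ exists f : 'rV[R[i]]_m -> R[i],
      [/\ entire f, transcendental f &
          forall z : 'rV[R[i]]_m,
            f z ^+ 3 + iter l (dirder u) f z =
            p1 * cexp (pairing lam z) + p2 * cexp (- pairing lam z)].
Proof.
move=> [f [/entire_line_holomorphic nf _ eqf]].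
have [c0|c0] := eqVneq (pairing lam u) 0; last first.
  apply: (no_solution_on_line (kappa := 1) nf hl hp1 hp2 c0) => z.
  by rewrite mul1r.
have d0 := dirder_eq0_of_constant_rhs nf hl1 c0 eqf.
pose k0 : 'I_m := Ordinal hm.
have lk0 : pairing lam (delta_mx 0 k0) != 0 by rewrite pairing_delta.
(* The equation has become [f ^ 3] equal to the right-hand side. In a coordinate direction the
   pairing is an entry of [lam], hence non-zero; with [kappa = 0] any odd order will do, here 1. *)
apply: (no_solution_on_line (kappa := 0) (l := 1) nf isT hp1 hp2 lk0) => z.
by rewrite mul0r -eqf iter_dirder_eq0.
Qed.
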